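(* Let $G:\mathbb{C}\to\mathbb{C}^{m\times m}$ be a discrete-time, symmetric, real, rational, proper transfer function. Then $G(z)$ is D-NI if and only if all of the following hold: (i) $G(z)$ has no poles in $|z|>1$; (ii) $i\,[G(e^{i\theta})-G(e^{i\theta})^*]\ge0$ for all $\theta\in(0,\pi)$ except for the values of $\theta$ for which $z=e^{i\theta}$ is a pole of $G(z)$; (iii) if $z_0=e^{i\theta_0}$, with $\theta_0\in(0,\pi)$, is a pole of $G(z)$, then it is a simple pole and the normalized residual matrix $K_0=\frac{1}{z_0}\lim_{z\to z_0}(z-z_0)\,i\,G(z)$ is Hermitian and positive semidefinite; (iv) if $z_0=1$ is a pole of $G(z)$, then it is at most a double pole, and its residue $A_1$ and its quadratic residue $A_2$ (with $A_2=0$ when the pole is simple) are Hermitian matrices satisfying $A_2\ge0$ and $A_1\ge A_2$; (v) if $z_0=-1$ is a pole of $G(z)$, then it is at most a double pole, and its residue $A_1$ and its quadratic residue $A_2$ (with $A_2=0$ when the pole is simple) are Hermitian matrices satisfying $A_2\le0$ and $A_1\ge -A_2$.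
   Context: $i$ is the imaginary unit; $A^*$ is the conjugate transpose; $\ge0$ (likewise $\le 0$) denotes positive semidefiniteness of Hermitian matrices, and $A\ge B$ means $A-B\ge0$. A rational transfer function is real if its entries are rational functions with real coefficients, symmetric if $G(z)=G(z)^\top$, and proper if $G(\infty)$ is finite. If $p$ is a (at most) double pole of $G$, write uniquely $G(z)=G_1(z)+\frac{A_1}{z-p}+\frac{A_2}{(z-p)^2}$ with $G_1$ rational and analytic in an open set containing $p$; $A_1$ is the residue and $A_2$ the quadratic residue at $p$. D-NI (discrete negative imaginary): a real transfer function $G$ that is analytic in $\{|z|>1\}$ and such that, for all $z$ with $|z|>1$: $i[G(z)-G(z)^*]\ge0$ if $\mathrm{Im}\,z>0$; $i[G(z)-G(z)^*]=0$ if $\mathrm{Im}\,z=0$; $i[G(z)-G(z)^*]\le0$ if $\mathrm{Im}\,z<0$. *)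

(* Defs.v *)
From HB Require Import structures.
From mathcomp Require Import all_boot all_order all_algebra.
From mathcomp Require Import all_classical all_reals all_analysis.
From mathcomp Require Import complex.

Set Implicit Arguments.
Unset Strict Implicit.
Unset Printing Implicit Defensive.

Import Order.TTheory GRing.Theory Num.Theory.
Import numFieldNormedType.Exports.

Local Open Scope classical_set_scope.
Local Open Scope sesquilinear_scope.
Local Open Scope ring_scope.
Local Open Scope complex_scope.

(* The representative chosen by [repr] need not be in lowest terms, hence the
   division by the gcd.  Numerator and denominator are determined only up to
   a common nonzero constant, which affects neither values nor poles. *)
Definition ratf_num (F : fieldType) (f : {fraction {poly F}}) : {poly F} :=
  let: (p, q) := frac (repr f) in p %/ gcdp p q.

Definition ratf_den (F : fieldType) (f : {fraction {poly F}}) : {poly F} :=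
  let: (p, q) := frac (repr f) in q %/ gcdp p q.

(* As [x / 0 = 0], the value at a pole is 0; since |f| tends to infinity
   there, the resulting total function is discontinuous exactly at the poles
   of [f]. *)
Definition ratf_eval (F : fieldType) (f : {fraction {poly F}}) (z : F) : F :=
  (ratf_num f).[z] / (ratf_den f).[z].

Definition transfer_function (R : realType) (m : nat) : Type :=
  'M[{fraction {poly R[i]}}]_m.

Section TransferFunction.
Variables (R : realType) (m : nat).
Local Notation C := R[i].
Implicit Types (A B : 'M[C]_m) (G : transfer_function R m) (z p : C).

(* The order of [R[i]] is partial: [0 <= c] says that c is real and >= 0. *)
Definition psdmx A : Prop :=
  A \is hermsymmx /\ forall x : 'cV[C]_m, 0 <= (x^t* *m A *m x) 0 0.

Definition loewner_le A B : Prop := psdmx (B - A).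

Definition tf_eval G z : 'M[C]_m := map_mx (fun f => ratf_eval f z) G.

Definition tf_real G : Prop :=
  forall i j, exists p q : {poly R}, q != 0 /\
    G i j = FracField.tofrac (map_poly (real_complex R) p)
            / FracField.tofrac (map_poly (real_complex R) q).

(* G(oo) is the limit of G(1/w) as w -> 0, w <> 0. *)
Definition tf_proper G : Prop :=
  exists L : 'M[C^o]_m,
    (tf_eval G w^-1 : 'M[C^o]_m) @[w --> (0 : C^o)^'] --> L.

(* Complex differentiability at every point of U (open in all uses below). *)
Definition tf_analytic_on (U : set C^o) G : Prop :=
  forall z, U z -> derivable (tf_eval G : C^o -> 'M[C^o]_m) z 1.

Definition pole_order G p : nat :=
  (\max_(i < m) \max_(j < m) mup p (ratf_den (G i j)))%N.

Definition is_pole G p : Prop := (0 < pole_order G p)%N.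

Definition tf_const A : transfer_function R m :=
  map_mx (fun c => FracField.tofrac c%:P) A.

(* A1 and A2 are the residue and the quadratic residue of G at p.  They are
   uniquely determined, exist iff the pole order is at most 2, and A2 = 0 if
   it is at most 1. *)
Definition has_residues G p A1 A2 : Prop :=
  let u := (FracField.tofrac ('X - p%:P))^-1 in
  exists2 G1 : transfer_function R m,
    G = G1 + u *: tf_const A1 + (u ^+ 2) *: tf_const A2 &
    exists2 U : set C^o, open_nbhs (p : C^o) U & tf_analytic_on U G1.

(* i [G(z) - G(z)^* ] *)
Definition ni_mx G z : 'M[C]_m := 'i%C *: (tf_eval G z - (tf_eval G z)^t*).

Definition D_NI G : Prop :=
  [/\ tf_real G,
      tf_analytic_on [set z | 1 < `|z|] G &
      forall z, 1 < `|z| ->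
        [/\ 0 < complex.Im z -> loewner_le 0 (ni_mx G z),
            complex.Im z = 0 -> ni_mx G z = 0 &
            complex.Im z < 0 -> loewner_le (ni_mx G z) 0]].

Definition normalized_residual G p : 'M[C]_m :=
  p^-1 *: (lim (((z - p) *: ('i%C *: tf_eval G z) : 'M[C^o]_m)
                 @[z --> (p : C^o)^']) : 'M[C]_m).

End TransferFunction.

(* e^(i theta) *)
Definition cis (R : realType) (theta : R) : R[i] := cos theta +i* sin theta.

(* Main.v *)
Require Import Defs.
From mathcomp Require Import all_boot all_order all_algebra.
From mathcomp Require Import all_classical all_reals all_analysis.
From mathcomp Require Import complex.
From mathcomp Require Import ring lra.

(** Let [D] be the part of the upper half plane outside the closed unit disk.

    Since [G] is symmetric, so is the matrix [i (G(z) - G(z)^* )], and a complex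
    symmetric matrix is positive semidefinite as soon as its quadratic form is
    nonnegative at real vectors ([psdmx_sym]).  For real [x] that form is
    [-2 Im f(z)], where [f := x^T G x] is a real rational function
    ([niform_ge0]).  Everything therefore reduces to the scalar condition
    [Im f <= 0] on [D], for all real [x]; on the real axis [Im f = 0], and the
    lower half plane follows by conjugation.

    Necessity is local.  If [b (z - z0)^(-k)] is the leading Laurent term of
    [f] at a boundary point [z0], then approaching [z0] along rays shows that
    [Im (b / w^k) <= 0] for every direction [w] pointing into [D]
    ([Im_leading_coef_le0]).  On the open arc these directions fill a half
    plane: their [k]-th powers go round the circle when [k >= 2], so that
    [b = 0], while [k = 1] says exactly that [i b / z0 >= 0].  At [1] and [-1]
    only a quarter plane of directions is available, which excludes the orders
    [k >= 3] and gives the sign of the double pole.  The condition that links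
    the two residues comes from the circle itself: there the term of order two,
    written as a multiple of a Koebe term, is real, and what is seen is the
    sign of the remaining simple pole ([real_residue_ge0]).

    Sufficiency is a maximum principle.  The Koebe terms
    [z / ((z - z0) (z - conj z0))] with [|z0| = 1] have imaginary part [<= 0] on
    [D] and [0] on the circle ([koebe_Im]).  Subtracting nonnegative multiples
    of them removes the poles on the open arc and the double poles at [1] and
    [-1], without changing the imaginary part on the circle.  What is left, say
    [g], has on the boundary of [D] at most simple poles at [1] and [-1], with
    residues [>= 0], so [Im g] cannot be large near them; it is [<= 0] on the
    arc, [0] on the real axis, and tends to [0] at infinity because a proper
    real function has a real value there.  A positive value of [Im g] on [D]
    would thus give a maximum at an interior point, against the open mapping
    property ([boundary_maximum_principle]). *)

Set Implicit Arguments.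
Unset Strict Implicit.
Unset Printing Implicit Defensive.

Import Order.TTheory GRing.Theory Num.Theory.
Import numFieldNormedType.Exports.

Local Open Scope classical_set_scope.
Local Open Scope sesquilinear_scope.
Local Open Scope ring_scope.
Local Open Scope complex_scope.

(** * Rational functions and their local rings *)

Section FractionNormalForm.
Variable K : fieldType.
Implicit Types f : {fraction {poly K}}.

Lemma pi_fracM (x : {ratio {poly K}}) :
  \pi_{fraction {poly K}}%qT x * FracField.tofrac (frac x).2 = FracField.tofrac (frac x).1.
Proof.
have d0 := denom_ratioP x.
unlock FracField.tofrac.
rewrite -[LHS]FracField.pi_mul /FracField.mulf.
apply/eqmodP; rewrite /= FracField.equivfE !numden_Ratio ?mulf_neq0 ?oner_eq0 //.
by rewrite !mulr1 mulrC.
Qed.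

Lemma repr_fracE f : f = FracField.tofrac (frac (repr f)).1 / FracField.tofrac (frac (repr f)).2.
Proof.
have dF : FracField.tofrac (frac (repr f)).2 != 0 by rewrite tofrac_eq0 denom_ratioP.
by rewrite -pi_fracM reprK mulfK.
Qed.

Lemma ratf_numE f : ratf_num f = (frac (repr f)).1 %/ gcdp (frac (repr f)).1 (frac (repr f)).2.
Proof. by rewrite /ratf_num; case: (frac _). Qed.

Lemma ratf_denE f : ratf_den f = (frac (repr f)).2 %/ gcdp (frac (repr f)).1 (frac (repr f)).2.
Proof. by rewrite /ratf_den; case: (frac _). Qed.

Lemma ratf_den_neq0 f : ratf_den f != 0.
Proof.
rewrite ratf_denE dvdp_div_eq0 ?dvdp_gcdr //; exact: denom_ratioP.
Qed.

Lemma ratf_coprime f : coprimep (ratf_num f) (ratf_den f).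
Proof.
rewrite ratf_numE ratf_denE coprimep_div_gcd //.
by rewrite denom_ratioP orbT.
Qed.

Lemma ratfE f : f = FracField.tofrac (ratf_num f) / FracField.tofrac (ratf_den f).
Proof.
rewrite {1}(repr_fracE f) ratf_numE ratf_denE.
set n := (frac _).1; set d := (frac _).2.
have d0 : d != 0 by exact: denom_ratioP.
have g0 : gcdp n d != 0 by rewrite gcdp_eq0 negb_and d0 orbT.
have nE : FracField.tofrac n = FracField.tofrac (n %/ gcdp n d) * FracField.tofrac (gcdp n d).
  by rewrite -tofracM divpK ?dvdp_gcdl.
have dE : FracField.tofrac d = FracField.tofrac (d %/ gcdp n d) * FracField.tofrac (gcdp n d).
  by rewrite -tofracM divpK ?dvdp_gcdr.
by rewrite nE dE -mulf_div divff ?mulr1 // tofrac_eq0.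
Qed.

End FractionNormalForm.

(** A field of fractions of [{poly K}] together with reduced numerators and
    denominators.  The whole argument depends on these data only; keeping the
    field abstract prevents conversion from unfolding the quotient that
    implements [{fraction {poly K}}]. *)
Record ratfun_field (K : fieldType) := RatfunField {
  rf_sort :> fieldType;
  rf_poly : {rmorphism {poly K} -> rf_sort};
  rf_num : rf_sort -> {poly K};
  rf_den : rf_sort -> {poly K};
  rf_poly_eq0 : forall p, (rf_poly p == 0) = (p == 0);
  rf_den_neq0 : forall f, rf_den f != 0;
  rf_coprime : forall f, coprimep (rf_num f) (rf_den f);
  rfE : forall f, f = rf_poly (rf_num f) / rf_poly (rf_den f) }.

Arguments rf_poly {K F} : rename.
Arguments rf_num {K F} f : rename.
Arguments rf_den {K F} f : rename.

Definition fraction_ratfun (K : fieldType) : ratfun_field K :=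
  @RatfunField K {fraction {poly K}} (@FracField.tofrac {poly K})
    (@ratf_num K) (@ratf_den K) (@tofrac_eq0 {poly K})
    (@ratf_den_neq0 K) (@ratf_coprime K) (@ratfE K).

Section RationalFunctions.
Variables (K : fieldType) (F : ratfun_field K).
Local Notation "p %:F" := (@rf_poly K F p) (at level 1, format "p %:F").
Implicit Types (f g : F) (p q n d : {poly K}) (z c : K).

Definition rf_eval f z : K := (rf_num f).[z] / (rf_den f).[z].

Lemma eq_rf_div n d n' d' : d != 0 -> d' != 0 ->
  n%:F / d%:F = n'%:F / d'%:F :> F -> n * d' = n' * d.
Proof.
move=> d0 d'0 /eqP; rewrite eqr_div ?rf_poly_eq0 // -!rmorphM -subr_eq0.
by rewrite -rmorphB rf_poly_eq0 subr_eq0 => /eqP.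
Qed.

Lemma rf_cross n d : d != 0 ->
  rf_num (n%:F / d%:F) * d = n * rf_den (n%:F / d%:F).
Proof.
by move=> d0; apply: eq_rf_div; rewrite ?rf_den_neq0 // -rfE.
Qed.

Lemma rf_den_dvd n d : d != 0 -> rf_den (n%:F / d%:F) %| d.
Proof.
move=> d0; rewrite -(Gauss_dvdpr _ (q := rf_num (n%:F / d%:F))).
  by rewrite rf_cross // dvdp_mull.
by rewrite coprimep_sym rf_coprime.
Qed.

(** The rational functions without pole at [z] form the local ring of [z];
    evaluation at [z] is its residue map. *)
Definition regular z f := ~~ root (rf_den f) z.

Lemma regular_frac z n d : ~~ root d z ->
  regular z (n%:F / d%:F) /\ rf_eval (n%:F / d%:F) z = n.[z] / d.[z].
Proof.
move=> dz.
have d0 : d != 0 by apply: contraNneq dz => ->; rewrite root0.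
have rz : regular z (n%:F / d%:F).
  by apply: contraNN dz; rewrite -!dvdp_XsubCl => /dvdp_trans; apply; apply: rf_den_dvd.
split=> //; rewrite /rf_eval.
apply/eqP; rewrite eqr_div //; apply/eqP.
by rewrite -!hornerM rf_cross.
Qed.

Lemma regular_ratP z f : regular z f -> exists n d,
  [/\ ~~ root d z, f = n%:F / d%:F & rf_eval f z = n.[z] / d.[z]].
Proof.
move=> rz; exists (rf_num f), (rf_den f); split=> //; exact: rfE.
Qed.

Lemma regularD_eval z f g : regular z f -> regular z g ->
  regular z (f + g) /\ rf_eval (f + g) z = rf_eval f z + rf_eval g z.
Proof.
move=> /regular_ratP[n [d [dz -> ->]]] /regular_ratP[n' [d' [d'z -> ->]]].
have d0 : d%:F != 0.
  by rewrite rf_poly_eq0; apply: contraNneq dz => ->; rewrite root0.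
have d'0 : d'%:F != 0.
  by rewrite rf_poly_eq0; apply: contraNneq d'z => ->; rewrite root0.
have dd'z : ~~ root (d * d') z by rewrite rootM negb_or dz.
have [r e] := regular_frac (n * d' + n' * d) dd'z.
have -> : n%:F / d%:F + n'%:F / d'%:F = (n * d' + n' * d)%:F / (d * d')%:F.
  by rewrite [in RHS]rmorphD !rmorphM; apply: addf_div.
by split=> //; rewrite e hornerD !hornerM; apply/esym/addf_div.
Qed.

Lemma regularM_eval z f g : regular z f -> regular z g ->
  regular z (f * g) /\ rf_eval (f * g) z = rf_eval f z * rf_eval g z.
Proof.
move=> /regular_ratP[n [d [dz -> ->]]] /regular_ratP[n' [d' [d'z -> ->]]].
have dd'z : ~~ root (d * d') z by rewrite rootM negb_or dz.
have [r e] := regular_frac (n * n') dd'z.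
have -> : n%:F / d%:F * (n'%:F / d'%:F) = (n * n')%:F / (d * d')%:F.
  by rewrite !rmorphM; apply: mulf_div.
by split=> //; rewrite e !hornerM; apply/esym/mulf_div.
Qed.

Lemma regular_poly z p : regular z p%:F /\ rf_eval p%:F z = p.[z].
Proof.
have := @regular_frac z p 1; rewrite (rmorph1 (@rf_poly K F)) divr1 hornerC divr1; apply.
by rewrite root1.
Qed.

Lemma regularD z f g : regular z f -> regular z g -> regular z (f + g).
Proof. by move=> rf rg; case: (regularD_eval rf rg). Qed.

Lemma rf_evalD z f g : regular z f -> regular z g ->
  rf_eval (f + g) z = rf_eval f z + rf_eval g z.
Proof. by move=> rf rg; case: (regularD_eval rf rg). Qed.

Lemma regularM z f g : regular z f -> regular z g -> regular z (f * g).
Proof. by move=> rf rg; case: (regularM_eval rf rg). Qed.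

Lemma rf_evalM z f g : regular z f -> regular z g ->
  rf_eval (f * g) z = rf_eval f z * rf_eval g z.
Proof. by move=> rf rg; case: (regularM_eval rf rg). Qed.

Lemma regularP z p : regular z p%:F.
Proof. by case: (regular_poly z p). Qed.

Lemma rf_evalP z p : rf_eval p%:F z = p.[z].
Proof. by case: (regular_poly z p). Qed.

Lemma rf_evalC z c : rf_eval c%:P%:F z = c.
Proof. by rewrite rf_evalP hornerC. Qed.

Lemma regular0 z : regular z 0.
Proof. by rewrite -(rmorph0 (@rf_poly K F)) regularP. Qed.

Lemma rf_eval0 z : rf_eval (0 : F) z = 0.
Proof. by rewrite -(rmorph0 (@rf_poly K F)) rf_evalP horner0. Qed.

Lemma regularN z f : regular z f -> regular z (- f).
Proof.
move=> rf; rewrite -mulN1r -(rmorph1 (@rf_poly K F)) -rmorphN.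
by apply: regularM => //; exact: regularP.
Qed.

Lemma rf_evalN z f : regular z f -> rf_eval (- f) z = - rf_eval f z.
Proof.
move=> rf; rewrite -mulN1r -(rmorph1 (@rf_poly K F)) -rmorphN rf_evalM ?regularP //.
by rewrite rf_evalP hornerN hornerC mulN1r.
Qed.

Lemma regularB z f g : regular z f -> regular z g -> regular z (f - g).
Proof. by move=> rf rg; apply: regularD => //; apply: regularN. Qed.

Lemma rf_evalB z f g : regular z f -> regular z g ->
  rf_eval (f - g) z = rf_eval f z - rf_eval g z.
Proof. by move=> rf rg; rewrite rf_evalD ?regularN // rf_evalN. Qed.

Lemma regular_sum z (I : Type) (s : seq I) (h : I -> F) :
  (forall i, regular z (h i)) -> regular z (\sum_(i <- s) h i) /\
  rf_eval (\sum_(i <- s) h i) z = \sum_(i <- s) rf_eval (h i) z.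
Proof.
move=> rh; elim: s => [|i s [IHr IHe]].
  by rewrite !big_nil rf_eval0 regular0.
by rewrite !big_cons -IHe; apply: regularD_eval.
Qed.

(** A zero at [z] cancels a simple pole at [z]. *)
Lemma regular_divX z f : regular z f -> rf_eval f z = 0 ->
  regular z (f / ('X - z%:P)%:F).
Proof.
move=> rf /eqP; rewrite /rf_eval mulf_eq0 invr_eq0.
move=> /orP[/factor_theorem[q qE]|dz0]; last by case/negP: rf.
rewrite {1}(rfE f) qE rmorphM mulrAC mulfK ?rf_poly_eq0 ?polyXsubC_eq0 //.
by have [] := @regular_frac z q (rf_den f) rf.
Qed.

Lemma regular_invX z c : c != z ->
  regular z (('X - c%:P)%:F)^-1 /\ rf_eval (('X - c%:P)%:F)^-1 z = (z - c)^-1.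
Proof.
move=> zp; rewrite -[X in regular z X]mul1r -[X in rf_eval X]mul1r -(rmorph1 (@rf_poly K F)).
have -> : (z - c)^-1 = (1 : {poly K}).[z] / ('X - c%:P).[z].
  by rewrite hornerXsubC hornerC mul1r.
by apply: regular_frac; rewrite root_XsubC eq_sym.
Qed.

(** The denominator is a power of [X - z] times a polynomial that does not
    vanish at [z]; this gives access to the Laurent expansion at [z]. *)
Lemma mup_den_split z f : exists d1, [/\ ~~ root d1 z,
  rf_den f = d1 * ('X - z%:P) ^+ mup z (rf_den f) &
  f = (rf_num f)%:F / (d1%:F * ('X - z%:P)%:F ^+ mup z (rf_den f))].
Proof.
set k := mup _ _.
have d0 := rf_den_neq0 f.
have /dvdpP[d1 dE] : ('X - z%:P) ^+ k %| rf_den f by rewrite -mup_geq.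
exists d1; split=> //; last first.
  by rewrite -rmorphXn -rmorphM -dE -rfE.
apply/negP => /factor_theorem[d2 d1E].
have : ('X - z%:P) ^+ k.+1 %| rf_den f.
  by rewrite dE d1E -mulrA -exprS dvdp_mull.
by rewrite -mup_geq // ltnn.
Qed.

(** The order of the pole, which is a multiplicity in the reduced
    denominator, is the least power of [X - z] that makes [f] regular. *)
Lemma mup_den_leP z f k :
  (mup z (rf_den f) <= k)%N <-> regular z (('X - z%:P)%:F ^+ k * f).
Proof.
have X0 : ('X - z%:P)%:F != 0 by rewrite rf_poly_eq0 polyXsubC_eq0.
split.
  move=> le; have [d1 [rd dE fE]] := mup_den_split z f; rewrite {1}fE.
  have -> : ('X - z%:P)%:F ^+ k * ((rf_num f)%:F /
     (d1%:F * ('X - z%:P)%:F ^+ mup z (rf_den f))) =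
     (('X - z%:P) ^+ (k - mup z (rf_den f)) * rf_num f)%:F / d1%:F.
    have Xm0 : ('X - z%:P)%:F ^+ mup z (rf_den f) != 0 by rewrite expf_neq0.
    rewrite -{1}(subnK le) exprD rmorphM rmorphXn -!mulrA; congr (_ * _).
    by rewrite invfM mulrCA; congr (_ * _); rewrite mulrCA divff ?mulr1.
  by have [] := @regular_frac z (('X - z%:P) ^+ (k - mup z (rf_den f)) * rf_num f) d1 rd.
move=> /regular_ratP[n [d [dz fE _]]].
have d0 : d != 0 by apply: contraNneq dz => ->; rewrite root0.
have Xk0 : ('X - z%:P) ^+ k != 0 by rewrite expf_neq0 ?polyXsubC_eq0.
have e : f = n%:F / (d * ('X - z%:P) ^+ k)%:F.
  by rewrite rmorphM rmorphXn invfM mulrA -fE mulrC mulKf // expf_neq0.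
have dk0 : d * ('X - z%:P) ^+ k != 0 by rewrite mulf_neq0.
have := @rf_den_dvd n _ dk0; rewrite -e => /dvdpP[q qE].
have q0 : q != 0 by apply: contraNneq dk0 => q0; rewrite qE q0 mul0r.
have := congr1 (mup z) qE; rewrite mupMr // mup_XsubCX eqxx.
by rewrite mupM ?rf_den_neq0 // => ->; apply: leq_addl.
Qed.

(** At the exact order of the pole, this value is the leading Laurent
    coefficient. *)
Lemma eval_pole_neq0 z f k : mup z (rf_den f) = k -> (0 < k)%N ->
  rf_eval (('X - z%:P)%:F ^+ k * f) z != 0.
Proof.
move=> <- k0.
have X0 : ('X - z%:P)%:F != 0 by rewrite rf_poly_eq0 polyXsubC_eq0.
have [d1 [rd dE fE]] := mup_den_split z f; rewrite {2}fE.
set e := _ ^+ _; have e0 : e != 0 by rewrite expf_neq0.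
have -> : e * ((rf_num f)%:F / (d1%:F * e)) = (rf_num f)%:F / d1%:F.
  by rewrite invfM mulrCA; congr (_ * _); rewrite mulrCA divff ?mulr1.
have [_ ->] := regular_frac (rf_num f) rd.
rewrite mulf_neq0 ?invr_eq0 //.
have := rf_coprime f; rewrite coprimep_sym => /coprimep_root -> //.
by rewrite dE rootM -(prednK k0) exprS rootM root_XsubC eqxx orbT.
Qed.

End RationalFunctions.

(** * Limits and compactness in the complex plane *)

Section EvaluationLimits.
Variables (K : numFieldType) (F : ratfun_field K).
Variables (T : Type) (G : set_system T).
Context {FG : Filter G}.

Lemma cvg_horner (p : {poly K}) (h : T -> K) (z : K) :
  h @ G --> z -> p.[h t] @[t --> G] --> p.[z].
Proof.
move=> hz; elim/poly_ind: p => [|p c IH].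
  under eq_fun do rewrite horner0.
  by rewrite horner0; apply: cvg_cst.
under eq_fun do rewrite hornerMXaddC.
rewrite hornerMXaddC; apply: cvgD; last exact: cvg_cst.
exact: cvgM.
Qed.

Lemma cvg_rf_eval (f : F) (h : T -> K) (z : K) : regular z f ->
  h @ G --> z -> rf_eval f (h t) @[t --> G] --> rf_eval f z.
Proof.
move=> rz hz; apply: cvgM; first exact: cvg_horner.
by apply: cvgV; [exact: rz|exact: cvg_horner].
Qed.

(** Poles are isolated. *)
Lemma near_regular (f : F) (h : T -> K) (z : K) :
  h @ G --> z -> (\forall t \near G, h t != z) ->
  \forall t \near G, regular (h t) f.
Proof.
move=> hz hne; have [d1 [d1z dE _]] := mup_den_split z f.
have d1near : \forall t \near G, d1.[h t] != 0.
  by apply: (cvgr_neq0 d1.[z]) => //; exact: cvg_horner.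
apply: filterS2 d1near hne => t d1t tz.
rewrite /regular dE rootM negb_or d1t /=.
by rewrite rootE horner_exp hornerXsubC expf_eq0 subr_eq0 negb_and tz orbT.
Qed.

Lemma near_regularT (f : F) (h : T -> K) (z : K) : regular z f ->
  h @ G --> z -> \forall t \near G, regular (h t) f.
Proof. by move=> rz hz; apply: (cvgr_neq0 (rf_den f).[z]) => //; exact: cvg_horner. Qed.

Lemma cvg_line (h : T -> K) (z w : K) :
  h @ G --> 0 -> (z + h t * w) @[t --> G] --> z.
Proof.
move=> h0; have := @cvg_horner (z%:P + 'X * w%:P) h 0 h0.
by rewrite !hornerE; under eq_fun do rewrite !hornerE.
Qed.

Lemma cvg_mull (h : T -> K) (c l : K) :
  h @ G --> l -> c * h t @[t --> G] --> c * l.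
Proof. by move=> hl; apply: cvgM => //; exact: cvg_cst. Qed.

(** [(1 + t u) / (1 - t u)] is a rational stand-in for [exp (2 t u)]: for
    imaginary [u] and real [t] it has modulus [1]. *)
Lemma cvg_cayley (h : T -> K) (z u : K) : h @ G --> 0 ->
  z * ((1 + h t * u) / (1 - h t * u)) @[t --> G] --> z.
Proof.
move=> h0.
have hp := @cvg_line h 1 u h0.
have hm : 1 - h t * u @[t --> G] --> (1 : K).
  by have := @cvg_line h 1 (- u) h0; under eq_fun do rewrite mulrN.
have : z * ((1 + h t * u) / (1 - h t * u)) @[t --> G] --> z * (1 / 1).
  by apply: cvg_mull; apply: cvgM => //; apply: cvgV => //; exact: oner_neq0.
by rewrite divr1 mulr1.
Qed.
End EvaluationLimits.

Section ComplexTopology.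
Variable R : realType.
Local Notation C := R[i].
Local Notation Im := (@complex.Im R).
Local Notation Re := (@complex.Re R).

Lemma normc_ge_Im (z : C) : `|Im z|%:C <= `|z|.
Proof.
have i1 : `|'i : C| = 1 by rewrite normc_def /= expr0n expr1n add0r sqrtr1.
by have := normc_ge_Re (z * 'i); rewrite ReiNIm normrN normrM i1 mulr1.
Qed.

Lemma near_ballC (z : C) (e : R) : 0 < e ->
  \forall w \near (z : C^o), `|z - w| < e%:C.
Proof. by move=> e0; apply: (@nbhsx_ballx C C^o z e%:C); rewrite ltcR. Qed.

Lemma Im_continuous : continuous (Im : C^o -> R).
Proof.
move=> z; apply/(@cvgrPdist_lt R R (C^o) (nbhs (z : C^o)) _) => e e0.
apply: filterS (near_ballC z e0) => w /(le_lt_trans (normc_ge_Im (z - w))).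
by rewrite ltcR raddfB.
Qed.

Lemma gt0_complexP (e : C) : 0 < e -> exists2 r : R, 0 < r & e = r%:C.
Proof.
move=> e0; exists (Re e); first by move: e0; rewrite ltcE => /andP[_].
by rewrite RRe_real // gtr0_real.
Qed.

Lemma real_complex_continuous : continuous (real_complex R : R -> C^o).
Proof.
move=> x; apply/(@cvgrPdist_lt C C^o R (nbhs x) _) => e.
move=> /gt0_complexP[r r0 ->].
apply: filterS (@nbhsx_ballx R R x r r0) => y /=.
by rewrite -rmorphB normc_def /= expr0n addr0 sqrtr_sqr ltcR.
Qed.

Lemma cvg_Im (T : Type) (G : set_system T) (FG : Filter G)
    (h : T -> C^o) (l : C) :
  h @ G --> (l : C^o) -> Im (h t) @[t --> G] --> Im l.
Proof. by move=> hl; apply: cvg_comp hl _; exact: Im_continuous. Qed.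

Lemma cvg_Im_le0 (T : Type) (G : set_system T) (PG : ProperFilter G)
    (h : T -> C^o) (l : C) :
  h @ G --> (l : C^o) -> (\forall t \near G, Im (h t) <= 0) -> Im l <= 0.
Proof.
move=> hl hle; apply: (@cvgr_to_le _ G PG R (Im \o h)) => //.
exact: cvg_Im hl.
Qed.

Lemma compact_box (M : R) :
  compact [set z : C^o | (`|Re z| <= M) && (`|Im z| <= M)].
Proof.
pose h (p : R * R) : C^o := (p.1 +i* p.2).
have hc : continuous h.
  have -> : h = (fun p => p.1%:C + 'i * p.2%:C).
    by apply/funext => p; rewrite [LHS]complexE.
  move=> p; apply: cvgD.
    by apply: continuous_comp; [exact: cvg_fst|exact: real_complex_continuous].
  apply: cvgM; first exact: cvg_cst.
  by apply: continuous_comp; [exact: cvg_snd|exact: real_complex_continuous].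
have := @continuous_compact _ _ h (`[- M, M]%classic `*` `[- M, M]%classic).
set S := [set h x | x in _]; set T := (X in _ -> compact X).
suff -> : T = S.
  apply; first by apply: continuous_subspaceT.
  by apply: compact_setX; exact: segment_compact.
apply/seteqP; split=> [z /= /andP[h1 h2]|z /= [[x y] /= [h1 h2] <-]].
  exists (Re z, Im z); last by rewrite /h /=; case: (z).
  by split; rewrite /= in_itv /= -ler_norml.
move: h1 h2; rewrite /= !in_itv /= -!ler_norml => h1 h2.
by apply/andP; split.
Qed.

End ComplexTopology.

(** * Real rational functions *)

Section RealFractions.
Variable R : realType.
Local Notation C := R[i].
Local Notation Im := (@complex.Im R).
Local Notation Re := (@complex.Re R).
Local Notation rc := (real_complex R).
Variable F : ratfun_field C.
Local Notation "p %:F" := (@rf_poly C F p) (at level 1, format "p %:F").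
Implicit Types (f g : F) (z : C) (x : R).

Definition rf_real f := exists p q : {poly R},
  q != 0 /\ f = (map_poly rc p)%:F / (map_poly rc q)%:F.

Lemma horner_conjc (p : {poly R}) z :
  (map_poly rc p).[(conjc z)] = conjc (map_poly rc p).[z].
Proof.
rewrite -[RHS]horner_map -map_poly_comp; congr _.[_].
by apply: eq_map_poly => x /=; rewrite oppr0.
Qed.

(** The given real fraction [p0 / q0] may have common roots, so it has to be
    reduced before one can tell that its denominator does not vanish at [z]. *)
Lemma rf_real_conj f z : rf_real f -> regular z f ->
  regular (conjc z) f /\ rf_eval f (conjc z) = conjc (rf_eval f z).
Proof.
move=> [p0 [q0 [q00 fE]]] rz.
pose g := gcdp p0 q0; pose p := p0 %/ g; pose q := q0 %/ g.
have g0 : g != 0 by rewrite gcdp_eq0 negb_and q00 orbT.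
have cpq : coprimep p q by rewrite coprimep_div_gcd // q00 orbT.
have q1 : q != 0 by rewrite dvdp_div_eq0 ?dvdp_gcdr.
have {}fE : f = (map_poly rc p)%:F / (map_poly rc q)%:F.
  have pE : p0 = p * g by rewrite divpK ?dvdp_gcdl.
  have qE : q0 = q * g by rewrite divpK ?dvdp_gcdr.
  rewrite fE pE qE !rmorphM -mulf_div divff ?mulr1 //.
  by rewrite rf_poly_eq0 map_poly_eq0.
have mq1 : map_poly rc q != 0 by rewrite map_poly_eq0.
have dvd : map_poly rc q %| rf_den f.
  rewrite -(Gauss_dvdpr _ (q := map_poly rc p)).
    by rewrite [in rf_den _]fE -rf_cross // -fE dvdp_mull.
  by rewrite coprimep_map coprimep_sym.
have qz : ~~ root (map_poly rc q) z.
  by apply: contraNN rz; rewrite -!dvdp_XsubCl => /dvdp_trans; apply.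
have qzJ : ~~ root (map_poly rc q) (conjc z).
  by rewrite /root horner_conjc conjc_eq0.
have [rJ eJ] := @regular_frac _ F _ (map_poly rc p) _ qzJ.
have [_ e] := @regular_frac _ F _ (map_poly rc p) _ qz.
by rewrite fE; split=> //; rewrite eJ e !horner_conjc -conjc_inv -rmorphM.
Qed.

Lemma conjc_Im0 z : Im z = 0 -> (conjc z) = z.
Proof. by case: z => a b /= ->; rewrite oppr0. Qed.

Lemma rf_real_Im0 f z : rf_real f -> regular z f -> Im z = 0 ->
  Im (rf_eval f z) = 0.
Proof.
move=> rf rz z0; have [_] := rf_real_conj rf rz.
rewrite (conjc_Im0 z0).
case: (rf_eval f z) => a b /= [bE]; lra.
Qed.

Lemma rf_realD f g : rf_real f -> rf_real g -> rf_real (f + g).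
Proof.
move=> [p [q [q0 ->]]] [p' [q' [q'0 ->]]].
exists (p * q' + p' * q), (q * q'); rewrite mulf_neq0 //; split=> //.
by rewrite !(rmorphD, rmorphM) addf_div // rf_poly_eq0 map_poly_eq0.
Qed.

Lemma rf_realM f g : rf_real f -> rf_real g -> rf_real (f * g).
Proof.
move=> [p [q [q0 ->]]] [p' [q' [q'0 ->]]].
exists (p * p'), (q * q'); rewrite mulf_neq0 //; split=> //.
by rewrite !rmorphM mulf_div.
Qed.

Lemma rf_real_div (p q : {poly R}) : q != 0 ->
  rf_real ((map_poly rc p)%:F / (map_poly rc q)%:F).
Proof. by exists p, q. Qed.

Lemma rf_real_poly (p : {poly R}) : rf_real (map_poly rc p)%:F.
Proof.
exists p, 1; rewrite oner_neq0; split=> //.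
by rewrite !rmorph1 divr1.
Qed.

Lemma rf_realC x : rf_real (x%:C%:P)%:F.
Proof. by rewrite -(map_polyC rc); exact: rf_real_poly. Qed.

Lemma rf_real0 : rf_real 0.
Proof. by have := rf_realC 0; rewrite !rmorph0. Qed.

Lemma rf_realN f : rf_real f -> rf_real (- f).
Proof.
move=> rf; rewrite -mulN1r; apply: rf_realM => //.
by have := rf_realC (-1); rewrite rmorphN1 polyCN !(rmorphN, rmorph1).
Qed.

Lemma rf_realB f g : rf_real f -> rf_real g -> rf_real (f - g).
Proof. by move=> rf rg; apply: rf_realD => //; apply: rf_realN. Qed.

Lemma map_XsubC x : map_poly rc ('X - x%:P) = 'X - x%:C%:P.
Proof. by rewrite rmorphB /= map_polyX map_polyC. Qed.

Lemma rf_real_XsubC x : rf_real ('X - x%:C%:P)%:F.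
Proof. by rewrite -map_XsubC; exact: rf_real_poly. Qed.

Lemma rf_real_invX x : rf_real ('X - x%:C%:P)%:F^-1.
Proof.
have := @rf_real_div 1 ('X - x%:P) (negbT (polyXsubC_eq0 _)).
by rewrite map_XsubC !rmorph1 div1r.
Qed.

Lemma rf_real_sum (I : Type) (s : seq I) (h : I -> F) :
  (forall i, rf_real (h i)) -> rf_real (\sum_(i <- s) h i).
Proof.
move=> rh; elim: s => [|i s IH]; first by rewrite big_nil; exact: rf_real0.
by rewrite big_cons; apply: rf_realD.
Qed.

End RealFractions.

(** * Koebe terms *)

Section Koebe.
Variable R : realType.
Local Notation C := R[i].
Local Notation Im := (@complex.Im R).
Local Notation Re := (@complex.Re R).
Local Notation rc := (real_complex R).
Variable F : ratfun_field C.
Local Notation "p %:F" := (@rf_poly C F p) (at level 1, format "p %:F").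
Implicit Types (f g : F) (z w : C) (x : R).

Definition nrm z : R := Num.sqrt (Re z ^+ 2 + Im z ^+ 2).

Lemma normE z : `|z| = (nrm z)%:C. Proof. exact: normc_def. Qed.

Lemma nrm_ge0 z : 0 <= nrm z. Proof. exact: sqrtr_ge0. Qed.

Lemma nrm_sqr z : nrm z ^+ 2 = Re z ^+ 2 + Im z ^+ 2.
Proof. by rewrite sqr_sqrtr // addr_ge0 ?sqr_ge0. Qed.

Lemma nrm_eq0 z : (nrm z == 0) = (z == 0).
Proof. by rewrite -(inj_eq (@complexI R)) -normE normr_eq0. Qed.

Lemma nrm_gt0 z : (0 < nrm z) = (z != 0).
Proof. by rewrite lt0r nrm_eq0 nrm_ge0 andbT. Qed.

Lemma nrmM z w : nrm (z * w) = nrm z * nrm w.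
Proof. by apply: (@complexI R); rewrite rmorphM /= -!normE normrM. Qed.

Lemma nrmV z : nrm z^-1 = (nrm z)^-1.
Proof. by apply: (@complexI R); rewrite fmorphV /= -!normE normfV. Qed.

Lemma nrmJ z : nrm (conjc z) = nrm z.
Proof. by case: z => a b; rewrite /nrm /= sqrrN. Qed.

Lemma nrmB z w : nrm (z - w) = nrm (w - z).
Proof. by apply: (@complexI R); rewrite -!normE distrC. Qed.

Lemma nrm_gt1 z : (1 < nrm z) = (1 < Re z ^+ 2 + Im z ^+ 2).
Proof.
rewrite -nrm_sqr -[LHS]subr_gt0 -[RHS]subr_gt0.
have -> : nrm z ^+ 2 - 1 = (nrm z - 1) * (nrm z + 1) by ring.
by rewrite pmulr_lgt0 // ltr_wpDl ?nrm_ge0.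
Qed.

Lemma nrm_eq1 z : nrm z = 1 -> Re z ^+ 2 + Im z ^+ 2 = 1.
Proof. by rewrite -nrm_sqr => ->; rewrite expr1n. Qed.

Lemma ler_nrm_dist z w : `|nrm z - nrm w| <= nrm (z - w).
Proof.
have := ler_dist_dist z w.
rewrite (normE z) (normE w) (normE (z - w)) -rmorphB /= [X in X <= _]normc_def /=.
by rewrite expr0n addr0 sqrtr_sqr lecR.
Qed.

Lemma nrm_dist_continuous c : continuous (fun z : C^o => nrm (c - z)).
Proof.
move=> z; apply/(@cvgrPdist_lt R R (C^o) (nbhs (z : C^o)) _) => e e0.
apply: filterS (near_ballC z e0) => w; rewrite normE ltcR => zw.
apply: le_lt_trans (ler_nrm_dist _ _) _.
have -> : c - z - (c - w) = w - z by ring.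
by rewrite nrmB.
Qed.

Lemma nrm_continuous : continuous (nrm : C^o -> R).
Proof.
have -> : nrm = (fun z => nrm (0 - z)).
  by apply/funext => z; rewrite nrmB subr0.
exact: nrm_dist_continuous.
Qed.

Lemma Imc_div z w : Im (z / w) = Im (z * conjc w) / (Re w ^+ 2 + Im w ^+ 2).
Proof. by case: z w => [a b] [c d] /=; ring. Qed.

(** For [z0 = 1] this is the Koebe function [z / (1 - z)^2]; in general a pair
    of conjugate poles is placed on the circle of radius [|z0|]. *)
Definition koebe z0 : F :=
  'X%:F / (('X - z0%:P) * ('X - (conjc z0)%:P))%:F.

Lemma koebe_real z0 : rf_real (koebe z0).
Proof.
pose q : {poly R} := 'X^2 - (2 * Re z0)%:P * 'X + (Re z0 ^+ 2 + Im z0 ^+ 2)%:P.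
have qE : map_poly rc q = ('X - z0%:P) * ('X - (conjc z0)%:P).
  have gen s n : map_poly rc ('X^2 - s%:P * 'X + n%:P) =
      'X^2 - s%:C%:P * 'X + n%:C%:P.
    by rewrite !(rmorphD, rmorphB, rmorphN, rmorphM) /= !map_polyX !map_polyC.
  rewrite /q gen.
  have -> : ((2 * Re z0)%:C = z0 + conjc z0)%C.
    by case: z0 {q} => a b /=; apply/eqP; rewrite eq_complex /=; apply/andP; split; apply/eqP; ring.
  have -> : ((Re z0 ^+ 2 + Im z0 ^+ 2)%:C = z0 * conjc z0)%C.
    by case: z0 {q} => a b /=; apply/eqP; rewrite eq_complex /=; apply/andP; split; apply/eqP; ring.
  rewrite (polyCD z0) (polyCM z0); ring.
exists 'X, q; split; last by rewrite qE map_polyX.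
by rewrite -(map_poly_eq0 rc) qE mulf_neq0 ?polyXsubC_eq0.
Qed.

Lemma regular_koebe z0 z : z != z0 -> z != conjc z0 ->
  regular z (koebe z0) /\
  rf_eval (koebe z0) z = z / ((z - z0) * (z - conjc z0)).
Proof.
move=> zz0 zz0'; have := @regular_frac _ F z 'X (('X - z0%:P) * ('X - (conjc z0)%:P)).
by rewrite rootM !root_XsubC negb_or zz0 zz0' hornerM !hornerXsubC hornerX; apply.
Qed.

(** Multiply numerator and denominator by the conjugate of the denominator:
    with [|z0| = 1], the imaginary part of
    [z (conj z - conj z0) (conj z - z0)] is [Im z (1 - |z|^2)]. *)
Lemma koebe_Im z0 z : nrm z0 = 1 -> z != z0 -> z != conjc z0 ->
  exists2 k, 0 < k &
    Im (rf_eval (koebe z0) z) = Im z * (1 - nrm z ^+ 2) * k.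
Proof.
move=> /nrm_eq1 n1 zz0 zz0'; have [_ ->] := regular_koebe zz0 zz0'.
set D := (z - z0) * (z - conjc z0).
exists (Re D ^+ 2 + Im D ^+ 2)^-1.
  rewrite invr_gt0 -nrm_sqr exprn_gt0 // nrm_gt0.
  by rewrite mulf_neq0 ?subr_eq0.
rewrite Imc_div nrm_sqr; congr (_ / _); rewrite /D.
case: z z0 n1 {zz0 zz0' D} => [x y] [c s] /= n1.
transitivity (y * ((c ^+ 2 + s ^+ 2) - (x ^+ 2 + y ^+ 2))); last by rewrite n1.
by ring.
Qed.

Lemma koebe_Im_le0 z0 z : nrm z0 = 1 -> 0 <= Im z0 -> 1 < nrm z -> 0 < Im z ->
  regular z (koebe z0) /\ Im (rf_eval (koebe z0) z) <= 0.
Proof.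
move=> n0 i0 n1 i1.
have zz0 : z != z0 by apply: contraTneq n1 => ->; rewrite n0 ltxx.
have zz0' : z != conjc z0 by apply: contraTneq n1 => ->; rewrite nrmJ n0 ltxx.
split; first by have [] := regular_koebe zz0 zz0'.
have [k k0 ->] := koebe_Im n0 zz0 zz0'.
rewrite pmulr_lle0 // pmulr_rle0 // subr_le0 exprn_ege1 //; exact: ltW.
Qed.

Lemma koebe_Im_eq0 z0 z : nrm z0 = 1 -> nrm z = 1 -> z != z0 ->
  z != conjc z0 -> Im (rf_eval (koebe z0) z) = 0.
Proof.
move=> n0 n1 zz0 zz0'; have [k k0 ->] := koebe_Im n0 zz0 zz0'.
by rewrite n1 expr1n subrr mulr0 mul0r.
Qed.

(** Neighbourhoods of infinity, in the coordinate [1 / z]. *)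
Definition infty : set_system C^o := (fun w : C^o => w^-1) @ (0 : C^o)^'.

Global Instance infty_filter : ProperFilter infty.
Proof. by apply: fmap_proper_filter; exact: Proper_dnbhs_numFieldType. Qed.

Lemma near_inftyP (P : C -> Prop) :
  (\forall z \near infty, P z) <-> exists M, forall z, M < nrm z -> P z.
Proof.
split.
  move=> /(@nbhs_ballP C C^o)[e /= /gt0_complexP[r r0 ->]] sub.
  exists r^-1 => z rz.
  have z0 : z != 0 by rewrite -nrm_gt0; apply: lt_trans rz; rewrite invr_gt0.
  rewrite -[z]invrK; apply: sub; last by rewrite /= invr_neq0.
  rewrite -ball_normE /ball_ /= sub0r normrN normE nrmV ltcR.
  by rewrite invf_plt // posrE nrm_gt0.
move=> [M MP].
apply/(@nbhs_ballP C C^o); exists ((`|M| + 1)^-1)%:C.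
  by rewrite /= ltcR invr_gt0 ltr_wpDl.
move=> w; rewrite -ball_normE /ball_ /= sub0r normrN normE ltcR => wM w0.
apply: MP; rewrite nrmV; apply: le_lt_trans (ler_norm M) _.
apply: lt_trans (_ : `|M| + 1 < _); first by rewrite ltrDl.
by rewrite -[X in X < _]invrK ltf_pV2 // posrE ?nrm_gt0 // invr_gt0 ltr_wpDl.
Qed.

Lemma cvg_inv_infty : (z^-1 @[z --> infty]) --> (0 : C^o).
Proof.
apply: cvg_trans (_ : nbhs (0 : C^o)^' `=>` _); last exact: nbhs_dnbhs.
move=> A HA; rewrite /infty /fmap /=.
rewrite /nbhs /=; apply: filterS HA => w /=; by rewrite invrK.
Qed.

(** Only the imaginary part is asked to vanish at infinity: a proper real
    function tends to an arbitrary real value. *)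
Definition decays f := Im (rf_eval f z) @[z --> infty] --> (0 : R).

Lemma cvg_decays f : rf_eval f z @[z --> infty] --> (0 : C^o) -> decays f.
Proof. exact: (@cvg_Im R C^o infty _ (rf_eval f) 0). Qed.

(** For [|z0| = 1] the Koebe term is invariant under [z -> 1 / z], and it
    vanishes at [0]. *)
Lemma koebe_decays z0 : nrm z0 = 1 -> decays (koebe z0).
Proof.
move=> n0; apply: cvg_decays.
have n1 := nrm_eq1 n0.
have z0J : z0 * conjc z0 = 1.
  case: (z0) n1 => a b /= n1; apply/eqP; rewrite eq_complex /=.
  by apply/andP; split; apply/eqP; [rewrite -n1; ring|ring].
have z00 : 0 != z0 by rewrite eq_sym -nrm_gt0 n0.
have z0J0 : 0 != conjc z0 by rewrite eq_sym conjc_eq0 eq_sym.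
have [r0 e0] := regular_koebe z00 z0J0.
have : rf_eval (koebe z0) z^-1 @[z --> infty] --> (0 : C^o).
  have -> : (0 : C) = rf_eval (koebe z0) 0 by rewrite e0 mul0r.
  apply: (@cvg_rf_eval C F C^o infty _ (koebe z0) (fun z => z^-1) 0).
    exact: r0.
  exact: cvg_inv_infty.
apply: cvg_trans; apply: near_eq_cvg.
apply/near_inftyP; exists 1 => z nz.
have zz0 : z != z0 by apply: contraTneq nz => ->; rewrite n0 ltxx.
have zz0' : z != conjc z0 by apply: contraTneq nz => ->; rewrite nrmJ n0 ltxx.
have znz : z != 0 by rewrite -nrm_gt0 (lt_trans _ nz).
have [_ ->] := regular_koebe zz0 zz0'.
have w0 : z^-1 != z0.
  by apply: contraNneq zz0' => e; rewrite -[z]invrK e (mulr1_eq z0J).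
have w0' : z^-1 != conjc z0.
  by apply: contraNneq zz0 => e; rewrite -[z]invrK e (mulr1_eq (y := z0)) // mulrC.
have [_ ->] := regular_koebe w0 w0'.
have -> : (z^-1 - z0) * (z^-1 - conjc z0) = z^-1 * z^-1 * ((z - z0) * (z - conjc z0)).
  transitivity (z^-1 * z^-1 * (1 - (z0 + conjc z0) * z + z0 * conjc z0 * (z * z))).
    by rewrite mulrDl; field.
  rewrite z0J; congr (_ * _).
  rewrite -[X in X - _ + _]z0J; ring.
by field; rewrite znz !subr_eq0 zz0 zz0'.
Qed.

End Koebe.

(** * Open mapping property *)

Section OpenMapping.
Variable R : realType.
Local Notation C := R[i].
Local Notation Im := (@complex.Im R).
Local Notation Re := (@complex.Re R).
Local Notation rc := (real_complex R).
Variable F : ratfun_field C.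
Local Notation "p %:F" := (@rf_poly C F p) (at level 1, format "p %:F").
Implicit Types (f g : F) (z w : C) (x s a e : R).

Lemma Im_realM x z : Im (x%:C * z) = x * Im z.
Proof. by case: z => a b /=; rewrite mul0r addr0. Qed.

Lemma regular_delta f z0 e : regular z0 f -> 0 < e ->
  exists2 d, 0 < d & forall z, nrm (z0 - z) < d ->
    regular z f /\ `|Im (rf_eval f z0) - Im (rf_eval f z)| < e.
Proof.
move=> rz e0.
have FG : Filter (nbhs (z0 : C^o)) by exact: nbhs_filter.
have h1 := @near_regularT C F C^o (nbhs (z0 : C^o)) FG f idfun z0 rz cvg_id.
have h2 := @cvg_rf_eval C F C^o (nbhs (z0 : C^o)) FG f idfun z0 rz cvg_id.
have := @cvg_Im R C^o (nbhs (z0 : C^o)) FG _ _ h2.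
move=> /(@cvgrPdist_lt R R C^o (nbhs (z0 : C^o)) FG)/(_ e e0) h3.
have := @filterI _ _ FG _ _ h1 h3.
move=> /(@nbhs_ballP C C^o)[_ /= /gt0_complexP[d d0 ->]] sub.
exists d => // z zd; apply: sub.
by rewrite -ball_normE /ball_ /= normE ltcR.
Qed.

Lemma cvg_real0 : t%:C @[t --> (0 : R)^'+] --> (0 : C^o).
Proof.
apply: cvg_trans (@real_complex_continuous R 0).
by apply: cvg_app; apply: cvg_at_right_filter; exact: cvg_id.
Qed.
Lemma cvg_ray z0 w : (z0 + t%:C * w) @[t --> (0 : R)^'+] --> (z0 : C^o).
Proof. exact: (@cvg_line C R (0 : R)^'+ _ (fun t => t%:C) z0 w cvg_real0). Qed.

Lemma near_ray z0 w (d : R) : 0 < d ->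
  \forall t \near (0 : R)^'+, nrm (z0 - (z0 + t%:C * w)) < d.
Proof.
move=> d0; have H : \forall t \near (0 : R)^'+, `|z0 - (z0 + t%:C * w)| < d%:C.
  exact: (@cvg_ray z0 w _ (near_ballC z0 d0)).
by apply: filterS H => t; rewrite normE ltcR.
Qed.

(** Open mapping: the imaginary part of a nonconstant rational function
    increases along a suitable ray issued from any regular point. *)
Lemma Im_no_local_max g z0 d : regular z0 g ->
  g != (rf_eval g z0)%:P%:F -> 0 < d ->
  exists z, [/\ nrm (z0 - z) < d, regular z g &
    Im (rf_eval g z0) < Im (rf_eval g z)].
Proof.
move=> rz nc d0; set c := rf_eval g z0 in nc *.
have rphi : regular z0 (g - c%:P%:F) by apply: regularB => //; exact: regularP.
set phi := g - _ in rphi.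
have phi0 : phi != 0 by rewrite subr_eq0.
have n0 : rf_num phi != 0.
  by apply: contraNneq phi0 => n0; rewrite (rfE phi) n0 rmorph0 mul0r.
have ephi : rf_eval phi z0 = 0.
  by rewrite rf_evalB ?regularP // rf_evalC subrr.
have [k [q [qz nE]]] : exists k q, ~~ root q z0 /\ rf_num phi = q * ('X - z0%:P) ^+ k.
  have [k [q]] := multiplicity_XsubC (rf_num phi) z0.
  by rewrite n0 => qz nE; exists k, q.
have k0 : (0 < k)%N.
  rewrite lt0n; apply: contraNneq qz => kE.
  move/eqP: ephi; rewrite /rf_eval nE kE expr0 mulr1 mulf_eq0 invr_eq0.
  by case/orP=> // dz; case/negP: rphi.
pose psi : F := q%:F / (rf_den phi)%:F.
have [rpsi epsi] : regular z0 psi /\ rf_eval psi z0 = q.[z0] / (rf_den phi).[z0].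
  exact: regular_frac.
have psi0 : rf_eval psi z0 != 0 by rewrite epsi mulf_neq0 ?invr_eq0.
have gE : g = c%:P%:F + ('X - z0%:P)%:F ^+ k * psi.
  rewrite -[LHS](subrK c%:P%:F) addrC; congr (_ + _).
  by rewrite /psi mulrA -rmorphXn -rmorphM [_ * q]mulrC -nE -rfE.
(* Near [z0], [g - c] is [(X - z0)^k psi] with [psi z0 != 0].  In the
   direction [w] with [w^k psi(z0) = 'i], it is close to [t^k 'i]. *)
pose w : C := k.-root ('i%C / rf_eval psi z0).
have wk : w ^+ k * rf_eval psi z0 = 'i%C by rewrite rootCK // divfK.
pose h t := z0 + t%:C * w.
have hz := @cvg_ray z0 w.
have psih : w ^+ k * rf_eval psi (h t) @[t --> (0 : R)^'+] --> ('i%C : C^o).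
  rewrite -wk; apply: (@cvg_mull C R (0 : R)^'+ _ (fun t => rf_eval psi (h t))).
  exact: (@cvg_rf_eval C F R (0 : R)^'+ _ psi h z0).
have pos : \forall t \near (0 : R)^'+, 0 < Im (w ^+ k * rf_eval psi (h t)).
  apply: (@cvgr_gt R R (0 : R)^'+ _
    (fun t => Im (w ^+ k * rf_eval psi (h t))) (Im 'i%C)).
    exact: (@cvg_Im R R (0 : R)^'+ _ (fun t => w ^+ k * rf_eval psi (h t)) 'i%C).
  exact: ltr01.
have reg : \forall t \near (0 : R)^'+, regular (h t) psi.
  exact: (@near_regularT C F R (0 : R)^'+ _ psi h z0 rpsi hz).
near (0 : R)^'+ => t.
have t0 : 0 < t by near: t; exact: nbhs_right_gt.
have pt : 0 < Im (w ^+ k * rf_eval psi (h t)) by near: t.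
have rt : regular (h t) psi by near: t.
exists (h t); split.
- by near: t; exact: near_ray.
- rewrite gE; apply: regularD; first exact: regularP.
  by apply: regularM => //; rewrite -rmorphXn; exact: regularP.
have rX : regular (h t) (('X - z0%:P) ^+ k)%:F := regularP _ _ _.
rewrite [X in _ < Im (rf_eval X _)]gE -rmorphXn rf_evalD ?regularP //; last first.
  exact: regularM.
rewrite rf_evalM // !rf_evalP hornerC horner_exp hornerXsubC.
have -> : h t - z0 = t%:C * w by rewrite /h addrC addKr.
rewrite exprMn -mulrA -rmorphXn raddfD /= Im_realM ltrDl.
by rewrite mulr_gt0 // exprn_gt0.
Unshelve. all: by end_near. Qed.

End OpenMapping.

(** * Maximum principle *)

Section MaximumPrinciple.
Variable R : realType.
Local Notation C := R[i].
Local Notation Im := (@complex.Im R).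
Local Notation Re := (@complex.Re R).
Local Notation rc := (real_complex R).
Variable F : ratfun_field C.
Local Notation "p %:F" := (@rf_poly C F p) (at level 1, format "p %:F").
Implicit Types (f g : F) (z w : C) (x s a e : R).

Definition simple_pole (a s : R) : F :=
  a%:C%:P%:F * ('X - s%:C%:P)%:F^-1.

Lemma regular_simple_pole a s z : z != s%:C ->
  regular z (simple_pole a s) /\
  rf_eval (simple_pole a s) z = a%:C / (z - s%:C).
Proof.
move=> zs; have [r e] : regular z ('X - s%:C%:P)%:F^-1 /\
    rf_eval ('X - s%:C%:P)%:F^-1 z = (z - s%:C)^-1.
  by apply: regular_invX; rewrite eq_sym.
have rC := @regularP _ F z a%:C%:P.
by split; [exact: regularM|rewrite rf_evalM // e rf_evalC].
Qed.

Lemma simple_pole_real a s : rf_real (simple_pole a s).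
Proof. by apply: rf_realM; [exact: rf_realC|exact: rf_real_invX]. Qed.

Lemma simple_pole_Im_le0 a s z : 0 <= a -> 0 <= Im z -> z != s%:C ->
  Im (rf_eval (simple_pole a s) z) <= 0.
Proof.
move=> a0 z0 zs; have [_ ->] := regular_simple_pole a zs.
rewrite Imc_div Im_realM mulr_le0_ge0 //.
  rewrite mulr_ge0_le0 //; case: z z0 {zs} => x y /= y0.
  by rewrite subr0 oppr_le0.
by rewrite invr_ge0 addr_ge0 // sqr_ge0.
Qed.

(** Near a real point [s], a nonnegative residue pushes the imaginary part
    down, and what remains is real at [s]; so the imaginary part is bounded
    by any prescribed [e > 0]. *)
Lemma Im_lt_near_real_pole g s a e : rf_real g -> 0 <= a ->
  regular s%:C (g - simple_pole a s) -> 0 < e ->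
  exists2 d, 0 < d & forall z, 0 <= Im z -> z != s%:C -> nrm (s%:C - z) < d ->
    Im (rf_eval g z) < e.
Proof.
move=> rg a0 rs e0; have [d d0 dP] := regular_delta rs e0.
exists d => // z z0 zs zd; have [rz] := dP z zd.
have rr : rf_real (g - simple_pole a s).
  by apply: rf_realB => //; exact: simple_pole_real.
rewrite (rf_real_Im0 rr rs) // sub0r normrN => lt_e.
have [rp _] := regular_simple_pole a zs.
rewrite -[g](subrK (simple_pole a s)) rf_evalD // raddfD /=.
have := simple_pole_Im_le0 a0 z0 zs.
have := ler_norm (Im (rf_eval (g - simple_pole a s) z)).
by move: lt_e; lra.
Qed.

Lemma unit_real z : nrm z = 1 -> Im z = 0 -> z = 1%:C \/ z = (-1)%:C.
Proof.
move=> /nrm_eq1 n1 i0; move: n1; rewrite i0 expr0n addr0 => /eqP.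
rewrite sqrf_eq1 => /orP[] /eqP r1; [left|right];
  by apply/eqP; rewrite eq_complex r1 i0 !eqxx.
Qed.

(** The points [1] and [-1] and infinity are cut off from the domain, since
    [Im g] is smaller there than any given positive value; on the compact set
    that remains the maximum would be positive, hence off the boundary, hence a
    local maximum. *)
Theorem boundary_maximum_principle g :
  rf_real g ->
  (forall z, 1 < nrm z -> regular z g) ->
  (forall z, nrm z = 1 -> 0 < Im z -> regular z g /\ Im (rf_eval g z) <= 0) ->
  (forall s, s = 1 \/ s = -1 ->
     exists2 a, 0 <= a & regular s%:C (g - simple_pole a s)) ->
  decays g ->
  forall z, 1 < nrm z -> 0 < Im z -> Im (rf_eval g z) <= 0.
Proof.
move=> rg rout harc hs hdec z1 n1 i1; rewrite leNgt; apply/negP => h1.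
set e := Im (rf_eval g z1) in h1.
have [a1 a10 ra1] := hs 1 (or_introl erefl).
have [a2 a20 ra2] := hs (-1) (or_intror erefl).
have [d1 d10 H1] := Im_lt_near_real_pole rg a10 ra1 h1.
have [d2 d20 H2] := Im_lt_near_real_pole rg a20 ra2 h1.
have [M HM] : exists M, forall z, M < nrm z -> Im (rf_eval g z) < e.
  apply/near_inftyP.
  exact: (@cvgr_lt R C^o (@infty R) _ (fun z => Im (rf_eval g z)) 0 hdec e h1).
(* Outside [K], the values of [Im g] in the closure of [D] are below [e]. *)
pose K : set C^o := [set z | [/\ 0 <= Im z, 1 <= nrm z, nrm z <= M,
   d1 <= nrm (1%:C - z) & d2 <= nrm ((-1)%:C - z)]].
have Kz1 : K z1.
  have i1' := ltW i1.
  split=> //; [exact: ltW| | |]; rewrite leNgt; apply/negP.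
  - by move=> /HM; rewrite ltxx.
  - move=> lt1; suff /H1 : z1 != 1%:C by move=> /(_ i1' lt1); rewrite ltxx.
    by apply: contraTneq i1 => ->; rewrite ltxx.
  - move=> lt1; suff /H2 : z1 != (-1)%:C by move=> /(_ i1' lt1); rewrite ltxx.
    by apply: contraTneq i1 => ->; rewrite ltxx.
have regK z : K z -> regular z g.
  move=> [i0 n0 _ k1 k2]; move: n0; rewrite le_eqVlt => /orP[/eqP/esym n0|]; last exact: rout.
  move: i0; rewrite le_eqVlt => /orP[/eqP/esym i0|i0]; last by have [] := harc z n0 i0.
  have [zE|zE] := unit_real n0 i0.
    by move: k1; rewrite zE subrr leNgt /nrm /= expr0n addr0 sqrtr0 d10.
  by move: k2; rewrite zE subrr leNgt /nrm /= expr0n addr0 sqrtr0 d20.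
have clge (h : C^o -> R) y : continuous h -> closed [set z | y <= h z].
  move=> hc; apply: (@closed_comp C^o R h [set x | y <= x]); last exact: closed_ge.
  by move=> z _; exact: hc.
have clle (h : C^o -> R) y : continuous h -> closed [set z | h z <= y].
  move=> hc; apply: (@closed_comp C^o R h [set x | x <= y]); last exact: closed_le.
  by move=> z _; exact: hc.
have Kcl : closed K.
  have -> : K = [set z | 0 <= Im z] `&` [set z | 1 <= nrm z] `&`
     [set z | nrm z <= M] `&` [set z | d1 <= nrm (1%:C - z)] `&`
     [set z | d2 <= nrm ((-1)%:C - z)].
    by apply/seteqP; split=> z /=; [move=> [] |move=> [[[[]]]]].
  apply: closedI; last by apply: clge; exact: nrm_dist_continuous.
  apply: closedI; last by apply: clge; exact: nrm_dist_continuous.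
  apply: closedI; last by apply: clle; exact: nrm_continuous.
  apply: closedI; first by apply: clge; exact: Im_continuous.
  by apply: clge; exact: nrm_continuous.
have Kcpt : compact K.
  apply: (subclosed_compact Kcl (@compact_box R `|M|)) => z [_ _ nM _ _] /=.
  have nM' : `|z| <= `|M|%:C by rewrite normE lecR (le_trans nM) // ler_norm.
  by rewrite -!lecR !(le_trans _ nM') // ?normc_ge_Re ?normc_ge_Im.
have [zm /set_mem Km max] : exists2 c : C^o, c \in K &
    forall t : C^o, t \in K -> Im (rf_eval g t) <= Im (rf_eval g c).
  apply: (@compact_EVT_max C^o R (fun t => Im (rf_eval g t)) K _ Kcpt); first by exists z1.
  apply: continuous_in_subspaceT => z /set_mem /regK rz.
  have FG : Filter (nbhs (z : C^o)) by exact: nbhs_filter.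
  apply: (@cvg_Im R C^o (nbhs (z : C^o)) FG (rf_eval g)).
  exact: (@cvg_rf_eval C F C^o (nbhs (z : C^o)) FG g idfun z rz cvg_id).
have {}max z : K z -> Im (rf_eval g z) <= Im (rf_eval g zm).
  by move=> Kz; apply: max; apply/mem_set.
have em : e <= Im (rf_eval g zm) by exact: max.
have [im0 nm0 nmM km1 km2] := Km.
have im : 0 < Im zm.
  rewrite lt_neqAle im0 andbT; apply/eqP => i0.
  by move: em; rewrite (rf_real_Im0 rg (regK _ Km)) // leNgt h1.
have nm : 1 < nrm zm.
  rewrite lt_neqAle nm0 andbT; apply/eqP => n0.
  have [_] := harc zm (esym n0) im.
  by move=> /(le_trans em); rewrite leNgt h1.
(* A constant real function takes real values only, but [Im g] is positive
   at [zm]; the point [2] is just a real point of regularity. *)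
have gnc : g != (rf_eval g zm)%:P%:F.
  apply/eqP => gE; have r2 : regular 2%:C g.
    by apply: rout; rewrite /nrm /= expr0n addr0 sqrtr_sqr ger0_norm // ltr1n.
  have := rf_real_Im0 rg r2 erefl; rewrite gE rf_evalC => i0.
  by move: em; rewrite i0 leNgt h1.
have [d d0 dP] : exists2 d, 0 < d & forall z, nrm (zm - z) < d ->
    0 < Im z /\ 1 < nrm z.
  exists (Num.min (Im zm) (nrm zm - 1)).
    by rewrite lt_min im subr_gt0 nm.
  move=> z; rewrite lt_min => /andP[l1 l2]; split.
    have := normc_ge_Im (zm - z); rewrite normE lecR raddfB /= => l3.
    have := ler_norm (Im zm - Im z); lra.
  have l3 := ler_nrm_dist zm z.
  have := ler_norm (nrm zm - nrm z); lra.
have [z [zd rz]] := Im_no_local_max (regK _ Km) gnc d0.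
have [iz nz] := dP z zd.
have iz' := ltW iz.
apply/negP; rewrite -leNgt.
have [/HM lt_e|leM] := ltP M (nrm z); first exact: ltW (lt_le_trans lt_e em).
have z11 : z != 1%:C by apply: contraTneq iz => ->; rewrite ltxx.
have z12 : z != (-1)%:C by apply: contraTneq iz => ->; rewrite ltxx.
have [lt1|le1] := ltP (nrm (1%:C - z)) d1.
  by apply: ltW (lt_le_trans _ em); exact: H1.
have [lt2|le2] := ltP (nrm ((-1)%:C - z)) d2.
  by apply: ltW (lt_le_trans _ em); exact: H2.
by apply: max; split=> //; exact: ltW.
Qed.

End MaximumPrinciple.

(** * Sufficiency for scalar functions *)

Section ScalarSufficiency.
Variable R : realType.
Local Notation C := R[i].
Local Notation Im := (@complex.Im R).
Local Notation Re := (@complex.Re R).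
Local Notation rc := (real_complex R).
Variable F : ratfun_field C.
Local Notation "p %:F" := (@rf_poly C F p) (at level 1, format "p %:F").
Implicit Types (f g : F) (z w : C) (x s a e k : R).

(** A rational parametrization of the circle through [z] around [0], which
    runs counterclockwise from [z] at [t = 0]. *)
Definition cayley z (t : R) : C := z * ((1 + t%:C * 'i) / (1 - t%:C * 'i)).

Lemma cayley_den t : 1 - t%:C * 'i != 0 :> C.
Proof. by rewrite eq_complex /= !mul0r !subr0 !mulr0 subr0 oner_eq0. Qed.

Lemma nrm_cayley z t : nrm (cayley z t) = nrm z.
Proof.
rewrite /cayley !nrmM nrmV.
have -> : nrm (1 + t%:C * 'i) = nrm (1 - t%:C * 'i).
  rewrite -[LHS]nrmJ; congr nrm; apply/eqP; rewrite eq_complex /=.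
  by apply/andP; split; apply/eqP; ring.
by rewrite divff ?mulr1 // nrm_eq0 cayley_den.
Qed.

Lemma cayley_neq z t : z != 0 -> t != 0 -> cayley z t != z.
Proof.
move=> z0; apply: contraNneq => e.
have {e} : (1 + t%:C * 'i) / (1 - t%:C * 'i) = 1.
  by apply: (mulfI z0); rewrite mulr1.
move/(canRL (divfK (cayley_den t))); rewrite mul1r => /(congr1 Im) /=.
rewrite !mul0r !add0r !mulr1 !addr0 => tE; apply/eqP; lra.
Qed.

Lemma cvg_cayley0 z : cayley z t @[t --> (0 : R)^'+] --> (z : C^o).
Proof. exact: (@cvg_cayley C R (0 : R)^'+ _ (fun t => t%:C) z 'i (@cvg_real0 R)). Qed.

(** Functions that may be subtracted without affecting the boundary values of
    the imaginary part, except at the points of [L], where they may have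
    poles. *)
Definition lossless (T : F) (L : seq C) :=
  [/\ rf_real T, decays T,
   forall z, 1 < nrm z -> regular z T,
   forall z, 1 < nrm z -> 0 < Im z -> Im (rf_eval T z) <= 0 &
   forall z, nrm z = 1 -> 0 <= Im z -> z \notin L ->
     regular z T /\ Im (rf_eval T z) = 0].

Lemma decaysD f g : (forall z, 1 < nrm z -> regular z f) ->
  (forall z, 1 < nrm z -> regular z g) ->
  decays f -> decays g -> decays (f + g).
Proof.
move=> rf rg df dg; rewrite /decays.
have FI : Filter (@infty R) by exact: filter_filter.
have := @cvgD R R C^o (@infty R) FI _ _ _ _ df dg; rewrite addr0.
apply: cvg_trans; apply: near_eq_cvg; apply/near_inftyP; exists 1 => z nz /=.
by rewrite rf_evalD ?raddfD //; [exact: rf|exact: rg].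
Qed.

Lemma decaysZ k f : (forall z, 1 < nrm z -> regular z f) ->
  decays f -> decays (k%:C%:P%:F * f).
Proof.
move=> rf df; rewrite /decays.
have FI : Filter (@infty R) by exact: filter_filter.
have := @cvgM R C^o (@infty R) FI _ _ _ _ (@cvg_cst R k C^o (@infty R) FI) df; rewrite mulr0.
apply: cvg_trans; apply: near_eq_cvg; apply/near_inftyP; exists 1 => z nz /=.
by rewrite rf_evalM ?regularP ?rf_evalC ?Im_realM //; exact: rf.
Qed.

Lemma lossless0 L : lossless 0 L.
Proof.
split.
- exact: rf_real0.
- rewrite /decays; under eq_fun do rewrite rf_eval0; exact: cvg_cst.
- by move=> z _; exact: regular0.
- by move=> z _ _; rewrite rf_eval0.
- by move=> z _ _ _; rewrite rf_eval0; split=> //; exact: regular0.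
Qed.

Definition on_arc z := (nrm z == 1) && (0 <= Im z).

(** The second pole of a Koebe term, at the conjugate point, is on the closed
    upper arc only if both poles coincide at [1] or [-1]. *)
Lemma arc_conj z w : on_arc z -> on_arc w -> z != w -> z != conjc w.
Proof.
move=> /andP[_ z0] /andP[_ w0]; apply: contraNneq => zE; move: z0.
rewrite zE; case: w w0 {zE z} => a b /= b0; rewrite oppr_ge0 => b0'.
have -> : b = 0 by apply/eqP; rewrite eq_le b0 b0'.
by rewrite oppr0.
Qed.

Lemma losslessD k w T L : 0 <= k -> on_arc w -> lossless T L ->
  lossless (k%:C%:P%:F * koebe F w + T) (w :: L).
Proof.
move=> k0 aw [rT dT oT nT cT].
have [/eqP nw iw] := andP aw.
have rK z : 1 < nrm z -> regular z (koebe F w).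
  move=> nz.
  have zw : z != w by apply: contraTneq nz => ->; rewrite nw ltxx.
  have zw' : z != conjc w by apply: contraTneq nz => ->; rewrite nrmJ nw ltxx.
  by have [] := regular_koebe F zw zw'.
have rkK z : 1 < nrm z -> regular z (k%:C%:P%:F * koebe F w).
  by move=> nz; apply: regularM; [exact: regularP|exact: rK].
split.
- by apply: rf_realD => //; apply: rf_realM; [exact: rf_realC|exact: koebe_real].
- apply: decaysD; [exact: rkK|exact: oT| |exact: dT].
  by apply: decaysZ; [exact: rK|exact: koebe_decays].
- by move=> z nz; apply: regularD; [exact: rkK|exact: oT].
- move=> z nz iz; rewrite rf_evalD ?rkK ?oT // raddfD /=.
  rewrite rf_evalM ?regularP ?rK // rf_evalC Im_realM.
  have [_ h1] := koebe_Im_le0 F nw iw nz iz.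
  by rewrite -[X in _ <= X]addr0 lerD ?nT // mulr_ge0_le0.
- move=> z nz iz; rewrite in_cons negb_or => /andP[zw zL].
  have az : on_arc z by rewrite /on_arc nz eqxx iz.
  have zw' := arc_conj az aw zw.
  have [rz ez] := cT z nz iz zL.
  have [rk _] := regular_koebe F zw zw'.
  have rkk : regular z (k%:C%:P%:F * koebe F w).
    by apply: regularM => //; exact: regularP.
  split; first exact: regularD.
  rewrite rf_evalD // raddfD /= ez addr0.
  by rewrite rf_evalM ?regularP // rf_evalC Im_realM koebe_Im_eq0 ?mulr0.
Qed.

(** Distinct Koebe terms have distinct poles on the closed upper arc, so the
    poles can be removed one at a time. *)
Lemma lossless_cover f (L : seq C) : uniq L -> all on_arc L ->
  (forall z, on_arc z ->
     exists2 k, 0 <= k & regular z (f - k%:C%:P%:F * koebe F z)) ->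
  exists2 T, lossless T L & forall z, z \in L -> regular z (f - T).
Proof.
move=> uL aL hf; elim: L uL aL => [|w L IH] /=.
  by move=> _ _; exists 0 => //; exact: lossless0.
move=> /andP[wL uL] /andP[aw aL]; have [T lT rT] := IH uL aL.
have [k k0 rk] := hf w aw.
exists (k%:C%:P%:F * koebe F w + T); first exact: losslessD.
have [_ _ _ _ cT] := lT.
move=> z; rewrite in_cons => /predU1P[->|zL].
  rewrite opprD addrA; apply: regularB => //.
  by have [/eqP nw iw] := andP aw; have [] := cT w nw iw wL.
have az : on_arc z by exact: (allP aL).
have zw : z != w by apply: contraNneq wL => <-.
have [rK _] := regular_koebe F zw (arc_conj az aw zw).
rewrite [_ + T]addrC opprD addrA; apply: regularB; first exact: rT.
by apply: regularM => //; exact: regularP.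
Qed.

(** The Koebe terms take care of all the poles except for the simple poles
    at [1] and [-1].  These are first set aside to form [f0], and put back in
    [g := f - T], to which the maximum principle applies. *)
Theorem scalar_sufficiency f :
  rf_real f -> decays f ->
  (forall z, 1 < nrm z -> regular z f) ->
  (forall z, nrm z = 1 -> 0 < Im z -> regular z f -> Im (rf_eval f z) <= 0) ->
  (forall z, nrm z = 1 -> 0 < Im z ->
     exists2 k, 0 <= k & regular z (f - k%:C%:P%:F * koebe F z)) ->
  (forall s, s = 1 \/ s = -1 -> exists k a, [/\ 0 <= k, 0 <= a &
     regular s%:C (f - k%:C%:P%:F * koebe F s%:C - simple_pole F a s)]) ->
  forall z, 1 < nrm z -> 0 < Im z -> Im (rf_eval f z) <= 0.
Proof.
move=> rf df of_ cf pf sf.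
have [k1 [a1 [k10 a10 h1]]] := sf 1 (or_introl erefl).
have [k2 [a2 [k20 a20 h2]]] := sf (-1) (or_intror erefl).
pose f0 := f - simple_pole F a1 1 - simple_pole F a2 (-1).
have ne11 : 1%:C != (-1)%:C :> C.
  by rewrite eq_complex /= eqxx andbT -subr_eq0 opprK (_ : 1 + 1 = 2%:R) // pnatr_eq0.
have sp s a z : z != s%:C -> regular z (simple_pole F a s).
  by move=> zs; have [] := regular_simple_pole F a zs.
have hf0 z : on_arc z -> exists2 k, 0 <= k & regular z (f0 - k%:C%:P%:F * koebe F z).
  move=> /andP[/eqP nz]; rewrite le_eqVlt => /predU1P[/esym iz|iz].
    have [->|->] := unit_real nz iz.
      exists k1 => //.
      have -> : f0 - k1%:C%:P%:F * koebe F 1%:C =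
        f - k1%:C%:P%:F * koebe F 1%:C - simple_pole F a1 1 - simple_pole F a2 (-1).
        by rewrite /f0; ring.
      by apply: regularB => //; apply: sp.
    exists k2 => //.
    have -> : f0 - k2%:C%:P%:F * koebe F (-1)%:C =
      f - k2%:C%:P%:F * koebe F (-1)%:C - simple_pole F a2 (-1) - simple_pole F a1 1.
      by rewrite /f0; ring.
    by apply: regularB => //; apply: sp; rewrite eq_sym.
  have [k k0 rk] := pf z nz iz; exists k => //.
  have -> : f0 - k%:C%:P%:F * koebe F z =
    f - k%:C%:P%:F * koebe F z - simple_pole F a1 1 - simple_pole F a2 (-1).
    by rewrite /f0; ring.
  have zr s : z != s%:C by apply: contraTneq iz => ->; rewrite ltxx.
  by apply: regularB; [apply: regularB => //|]; apply: sp.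
have [rts rtsE] := closed_field_poly_normal (rf_den f0).
pose L := undup [seq z <- rts | on_arc z].
have notL z : on_arc z -> z \notin L -> regular z f0.
  move=> az; rewrite mem_undup mem_filter az /=; apply: contraNN.
  by rewrite rtsE rootZ ?lead_coef_eq0 ?rf_den_neq0 // root_prod_XsubC.
have Lnr z : regular z f0 -> z \notin L.
  apply: contraTN; rewrite mem_undup mem_filter => /andP[_ zr].
  by rewrite /regular negbK rtsE rootZ ?lead_coef_eq0 ?rf_den_neq0 // root_prod_XsubC.
have aL : all on_arc L by apply/allP => z; rewrite mem_undup mem_filter => /andP[].
have [T lT rT] := lossless_cover (undup_uniq _) aL hf0.
have [rlT dT oT nT cT] := lT.
have rT' z : on_arc z -> regular z (f0 - T).
  move=> az; have [/rT //|zL] := boolP (z \in L).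
  apply: regularB; first exact: notL.
  by have [/eqP nz iz] := andP az; have [] := cT z nz iz zL.
pose g := f - T.
have gE : g = f0 - T + simple_pole F a1 1 + simple_pole F a2 (-1).
  by rewrite /g /f0; ring.
have fE : f = f0 + simple_pole F a1 1 + simple_pole F a2 (-1).
  by rewrite /f0 addrAC subrK subrK.
have zr z s : 0 < Im z -> z != s%:C.
  by move=> iz; apply: contraTneq iz => ->; rewrite ltxx.
have garc z : nrm z = 1 -> 0 < Im z -> regular z g.
  move=> nz iz; rewrite gE; apply: regularD; last by apply: sp; exact: zr.
  apply: regularD; last by apply: sp; exact: zr.
  by apply: rT'; rewrite /on_arc nz eqxx ltW.
have gle z : nrm z = 1 -> 0 < Im z -> z \notin L -> Im (rf_eval g z) <= 0.
  move=> nz iz zL; have iz' := ltW iz; have [rz ez] := cT z nz iz' zL.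
  have az : on_arc z by rewrite /on_arc nz eqxx.
  have rfz : regular z f.
    by rewrite fE; apply: regularD; [apply: regularD; [exact: notL|]|]; apply: sp; exact: zr.
  by rewrite rf_evalB // raddfB /= ez subr0; exact: cf.
have gneg : forall z, 1 < nrm z -> 0 < Im z -> Im (rf_eval g z) <= 0.
  apply: boundary_maximum_principle.
  - exact: rf_realB.
  - by move=> z nz; apply: regularB; [exact: of_|exact: oT].
  - move=> z nz iz; split; first exact: garc.
    (* At the former poles [Im g <= 0] holds by continuity along the arc. *)
    have z0 : z != 0 by rewrite -nrm_gt0 nz.
    have hz := @cvg_cayley0 z.
    have hne : \forall t \near (0 : R)^'+, cayley z t != z.
      apply: filterS (@nbhs_right_gt R 0) => t t0.
      by apply: cayley_neq => //; rewrite gt_eqF.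
    have FI : Filter (0 : R)^'+ by exact: filter_filter.
    have hreg := @near_regular C F R (0 : R)^'+ FI f0 (cayley z) z hz hne.
    have hIm := @cvg_Im R R (0 : R)^'+ FI (cayley z) z hz.
    have hpos := @cvgr_gt R R (0 : R)^'+ FI _ _ hIm 0 iz.
    have hg := @cvg_rf_eval C F R (0 : R)^'+ FI g (cayley z) z (garc z nz iz) hz.
    apply: (@cvg_Im_le0 R R (0 : R)^'+ _ _ _ hg).
    apply: filterS2 hpos hreg => t ipos rt.
    by apply: gle => //; [rewrite nrm_cayley|exact: Lnr].
  - move=> s [->|->].
      exists a1 => //; rewrite gE.
      have -> : f0 - T + simple_pole F a1 1 + simple_pole F a2 (-1) - simple_pole F a1 1
        = f0 - T + simple_pole F a2 (-1) by rewrite addrAC addrK.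
      apply: regularD; last exact: sp.
      by apply: rT'; rewrite /on_arc /nrm /= expr0n addr0 expr1n sqrtr1 eqxx lexx.
    exists a2 => //; rewrite gE addrK.
    apply: regularD; last by apply: sp; rewrite eq_sym.
    by apply: rT'; rewrite /on_arc /nrm /= expr0n addr0 sqrrN expr1n sqrtr1 eqxx lexx.
  - rewrite /g -mulN1r; have -> : -1 = (-1)%:C%:P%:F :> F by rewrite !rmorphN1.
    apply: (decaysD of_ _ df); last by apply: decaysZ; [exact: oT|exact: dT].
    by move=> z nz; apply: regularM; [exact: regularP|exact: oT].
move=> z nz iz; rewrite -[f](subrK T) rf_evalD; last first.
- exact: oT.
- by apply: regularB; [exact: of_|exact: oT].
by rewrite raddfD /= -[X in _ <= X]addr0 lerD // ?gneg // nT.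
Qed.

End ScalarSufficiency.

(** * Necessity for scalar functions *)

Section ScalarNecessity.
Variable R : realType.
Local Notation C := R[i].
Local Notation Im := (@complex.Im R).
Local Notation Re := (@complex.Re R).
Local Notation rc := (real_complex R).
Variable F : ratfun_field C.
Local Notation "p %:F" := (@rf_poly C F p) (at level 1, format "p %:F").
Implicit Types (f g : F) (z w b v : C) (x s a e : R) (k : nat).

Lemma cisD x y : cis (x + y) = cis x * cis y :> C.
Proof. by apply/eqP; rewrite eq_complex /= cosD sinD eqxx [_ * _ + _]addrC eqxx. Qed.

Lemma cis0 : cis 0 = 1 :> C.
Proof. by rewrite /cis cos0 sin0. Qed.

Lemma cisX x k : cis x ^+ k = cis (x *+ k) :> C.
Proof. by elim: k => [|k IH]; rewrite ?cis0 // exprS IH mulrS cisD. Qed.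

Lemma cisN x : cis (- x) = (cis x)^-1 :> C.
Proof. by apply/esym/mulr1_eq; rewrite -cisD subrr cis0. Qed.

Lemma nrm_cis x : nrm (cis x) = 1.
Proof. by rewrite /nrm /= cos2Dsin2 sqrtr1. Qed.

(** On the ray, [t^k f(z0 + t w)] tends to [b / w^k], where [b] is the
    coefficient of order [k] at [z0]. *)
Lemma Im_leading_coef_le0 f z0 w k :
  (forall z, 1 < nrm z -> regular z f) ->
  (forall z, 1 < nrm z -> 0 < Im z -> Im (rf_eval f z) <= 0) ->
  (\forall t \near (0 : R)^'+, 1 < nrm (z0 + t%:C * w) /\ 0 < Im (z0 + t%:C * w)) ->
  w != 0 -> regular z0 (('X - z0%:P)%:F ^+ k * f) ->
  Im (rf_eval (('X - z0%:P)%:F ^+ k * f) z0 / w ^+ k) <= 0.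
Proof.
move=> rf nf nD w0 rh; set h := _ * f in rh *.
have FI : Filter (0 : R)^'+ by exact: filter_filter.
have hr := @cvg_ray R z0 w.
have hh := @cvg_rf_eval C F R (0 : R)^'+ FI h _ z0 rh hr.
have hc := @cvg_mull C R (0 : R)^'+ FI _ (w ^+ k)^-1 _ hh.
rewrite mulrC; apply: (@cvg_Im_le0 R R (0 : R)^'+ _ _ _ hc).
apply: filterS2 nD (@nbhs_right_gt R 0) => t [n1 i1] t0.
have rX : regular (z0 + t%:C * w) (('X - z0%:P) ^+ k)%:F := regularP _ _ _.
rewrite /h -rmorphXn rf_evalM ?rf //.
rewrite rf_evalP horner_exp hornerXsubC addrC addKr exprMn.
set E := rf_eval f _.
have -> : (w ^+ k)^-1 * (t%:C ^+ k * w ^+ k * E) = (t ^+ k)%:C * E.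
  by rewrite rmorphXn /= [_ * w ^+ k]mulrC -mulrA mulKf ?expf_neq0.
rewrite Im_realM.
by rewrite mulr_ge0_le0 ?nf // exprn_ge0 // ltW.
Qed.

(** At a point [z0] of the arc, the directions into [D] are the [z0 v] with
    [v] in the open right half plane. *)
Lemma near_arc_ray z0 v : nrm z0 = 1 -> 0 < Im z0 -> 0 < Re v ->
  \forall t \near (0 : R)^'+, 1 < nrm (z0 + t%:C * (z0 * v)) /\
    0 < Im (z0 + t%:C * (z0 * v)).
Proof.
move=> n0 i0 v0.
have FI : Filter (0 : R)^'+ by exact: filter_filter.
have hr := @cvg_ray R z0 (z0 * v).
have hI := @cvg_Im R R (0 : R)^'+ FI _ _ hr.
apply: filterS2 (@cvgr_gt R R (0 : R)^'+ FI _ _ hI 0 i0) (@nbhs_right_gt R 0).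
move=> t it t0; split=> //.
have -> : z0 + t%:C * (z0 * v) = z0 * (1 + t%:C * v) by ring.
rewrite nrmM n0 mul1r nrm_gt1.
case: v v0 {hr hI it} => a b /= a0.
have ta : 0 < t * a by rewrite mulr_gt0.
rewrite !mul0r subr0 !addr0; nra.
Qed.

(** At [s = 1] or [s = -1], an open quarter plane of directions enters
    [D]. *)
Lemma near_real_ray s a (c : R) : s = 1 \/ s = -1 -> 0 < a -> 0 < c ->
  \forall t \near (0 : R)^'+, 1 < nrm (s%:C + t%:C * ((s * a) +i* c)) /\
    0 < Im (s%:C + t%:C * ((s * a) +i* c)).
Proof.
move=> hs a0 c0.
apply: filterS (@nbhs_right_gt R 0) => t t0.
have ta : 0 < t * a by rewrite mulr_gt0.
have tc : 0 < t * c by rewrite mulr_gt0.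
split; last by rewrite /= mul0r addr0 add0r.
rewrite nrm_gt1 /= !mul0r subr0 addr0 add0r.
have s2 : s * s = 1 by case: hs => ->; ring.
have -> : (s + t * (s * a)) ^+ 2 = s * s * (1 + t * a) ^+ 2 by ring.
rewrite s2; nra.
Qed.

(** The [k]-th power, [k >= 2], spreads the right half plane over all
    directions except possibly the negative one, so that it rotates any
    nonzero [b] out of the lower half plane. *)
Lemma halfplane_pow_eq0 b k : (2 <= k)%N ->
  (forall v, 0 < Re v -> Im (b / v ^+ k) <= 0) -> b = 0.
Proof.
move=> k2 hb.
have kn : (2 : R) <= k%:R by rewrite ler_nat.
have k0 : 0 < k%:R :> R by lra.
have hth th : - pi < th < pi -> Im (b * cis (- th)) <= 0.
  move=> /andP[l u].
  have -> : cis (- th) = (cis (th / k%:R) ^+ k)^-1 :> C.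
    by rewrite cisX cisN -[_ / _ *+ k]mulr_natr divfK // gt_eqF.
  apply: hb => /=; apply: cos_gt0_pihalf; have p0 := pi_gt0 R.
  by rewrite ltr_pdivlMr // ltr_pdivrMr //; apply/andP; split; nra.
have p0 := pi_gt0 R.
(* The angles [0], [pi / 2] and [- pi / 2] show that [b] is on the lower half
   of the imaginary axis, and [3 pi / 4] excludes all but [0]. *)
have e0 : Im b <= 0.
  by have := hth 0; rewrite oppr0 cis0 mulr1; apply; apply/andP; split; lra.
have e1 : 0 <= Re b.
  have := hth (pi / 2); rewrite /cis cosN sinN cos_pihalf sin_pihalf.
  case: (b) => x y /=; rewrite mulr0 addr0 mulrN1 oppr_le0; apply.
  by apply/andP; split; lra.
have e2 : Re b <= 0.
  have := hth (- (pi / 2)); rewrite opprK /cis cos_pihalf sin_pihalf.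
  case: (b) => x y /=; rewrite mulr0 addr0 mulr1; apply.
  by apply/andP; split; lra.
have r0 : Re b = 0 by apply/eqP; rewrite eq_le e1 e2.
have e3 : 0 <= Im b.
  have := hth (pi / 4 + pi / 2).
  rewrite /cis cosN sinN cosDpihalf.
  have s4 : 0 < sin (pi / 4 : R) by apply: sin_gt0_pi; apply/andP; split; lra.
  case: (b) r0 => x y /= ->; rewrite mul0r add0r mulrN oppr_le0 pmulr_lge0 //.
  by apply; apply/andP; split; lra.
by apply/eqP; rewrite eq_complex /= r0 eqxx /= eq_le e0 e3.
Qed.

Lemma arc_pole_simple f z0 k : nrm z0 = 1 -> 0 < Im z0 ->
  (forall z, 1 < nrm z -> regular z f) ->
  (forall z, 1 < nrm z -> 0 < Im z -> Im (rf_eval f z) <= 0) ->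
  regular z0 (('X - z0%:P)%:F ^+ k * f) -> (2 <= k)%N ->
  rf_eval (('X - z0%:P)%:F ^+ k * f) z0 = 0.
Proof.
move=> n0 i0 rf nf rh k2; set b := rf_eval _ _.
have z00 : z0 != 0 by rewrite -nrm_gt0 n0.
suff : b / z0 ^+ k = 0.
  by move/eqP; rewrite mulf_eq0 invr_eq0 expf_eq0 (negPf z00) andbF orbF => /eqP.
apply: (halfplane_pow_eq0 k2) => v v0.
rewrite -mulrA -invfM -exprMn.
apply: Im_leading_coef_le0 => //; first exact: near_arc_ray.
by rewrite mulf_neq0 //; apply: contraTneq v0 => ->; rewrite ltxx.
Qed.

(** For [k = 1] the products [b / z0 / v] stay in the lower half plane when
    [v] runs over the right half plane; letting [v] approach the imaginary
    axis shows that [b / z0] is a nonpositive multiple of ['i]. *)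
Lemma arc_residue_ge0 f z0 : nrm z0 = 1 -> 0 < Im z0 ->
  (forall z, 1 < nrm z -> regular z f) ->
  (forall z, 1 < nrm z -> 0 < Im z -> Im (rf_eval f z) <= 0) ->
  regular z0 (('X - z0%:P)%:F * f) ->
  0 <= z0^-1 * ('i%C * rf_eval (('X - z0%:P)%:F * f) z0).
Proof.
move=> n0 i0 rf nf rh; set b := rf_eval _ _.
have z00 : z0 != 0 by rewrite -nrm_gt0 n0.
have hv v : 0 < Re v -> Im (b / z0 / v) <= 0.
  move=> v0; rewrite -mulrA -invfM -[z0 * v]expr1 /b.
  rewrite -[X in rf_eval (X * f)]expr1 in rh *.
  apply: Im_leading_coef_le0 => //; first exact: near_arc_ray.
  by rewrite mulf_neq0 //; apply: contraTneq v0 => ->; rewrite ltxx.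
have -> : z0^-1 * ('i%C * b) = 'i%C * (b / z0) by ring.
move: hv; case: (b / z0) => x y hv.
have y0 : y <= 0 by have := hv 1 ltr01; rewrite divr1.
(* The condition in the direction [e + o 'i], up to a positive factor. *)
have hs e (o : R) : 0 < e -> y * e - x * o <= 0.
  move=> e0; have := hv (e +i* o) e0; rewrite Imc_div /=.
  rewrite pmulr_lle0; first by lra.
  by rewrite invr_gt0 ltr_pwDl ?sqr_ge0 // exprn_gt0.
have key (u : R) : 0 < u -> exists2 e, 0 < e & - u < y * e.
  move=> u0; exists (u / (2 * (1 - y))); first by rewrite divr_gt0 //; lra.
  rewrite mulrA ltr_pdivlMr; nra.
have x0 : x = 0.
  apply/eqP; rewrite eq_le !leNgt; apply/andP; split; apply/negP => xx.
    have [e e0 he] := key x xx; have := hs e (-1) e0; lra.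
  have nx : 0 < - x by lra.
  have [e e0 he] := key (- x) nx.
  have := hs e 1 e0; lra.
by rewrite lecE /=; apply/andP; split; [apply/eqP; lra|lra].
Qed.

(** As [f] is real, [b] is real as well.  The angles of the directions into
    [D] fill an interval of length [pi / 2], so those of their [k]-th powers fill
    one of length at least [3 pi / 2], on which the sine changes its sign. *)
Lemma real_pole_order_le2 f s k : s = 1 \/ s = -1 -> rf_real f ->
  (forall z, 1 < nrm z -> regular z f) ->
  (forall z, 1 < nrm z -> 0 < Im z -> Im (rf_eval f z) <= 0) ->
  regular s%:C (('X - s%:C%:P)%:F ^+ k * f) -> (3 <= k)%N ->
  rf_eval (('X - s%:C%:P)%:F ^+ k * f) s%:C = 0.
Proof.
move=> hs rlf rf nf rh k3; set b := rf_eval _ _.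
have s2 : s * s = 1 by case: hs => ->; ring.
have s0 : s != 0 by apply: contra_eq_neq s2 => ->; rewrite mul0r eq_sym oner_neq0.
have b0 : Im b = 0.
  apply: rf_real_Im0 => //; apply: rf_realM => //.
  rewrite -rmorphXn -map_XsubC -rmorphXn; exact: rf_real_poly.
have kn : (3 : R) <= k%:R by rewrite ler_nat.
have k0 : 0 < k%:R :> R by lra.
have p0 := pi_gt0 R.
have hth th : 0 < th < 3 * (pi / 2) -> 0 <= s ^+ k.+1 * Re b * sin th.
  move=> /andP[l u]; pose ps := th / k%:R.
  have psl : 0 < ps by rewrite divr_gt0.
  have psu : ps < pi / 2 by rewrite ltr_pdivrMr //; nra.
  have c0 : 0 < cos ps by apply: cos_gt0_pihalf; apply/andP; split; lra.
  have sp0 : 0 < sin ps by apply: sin_gt0_pi; apply/andP; split; lra.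
  have wE : (s * cos ps) +i* sin ps = s%:C * cis (s * ps) :> C.
    apply/eqP; rewrite eq_complex /= !mul0r subr0 addr0.
    by case: hs => ->; rewrite !(mul1r, mulN1r, cosN, sinN, opprK) !eqxx.
  have w0 : s%:C * cis (s * ps) != 0 :> C.
    by rewrite -nrm_gt0 nrmM nrm_cis mulr1 nrm_gt0 eq_complex /= eqxx andbT.
  have := @Im_leading_coef_le0 f s%:C (s%:C * cis (s * ps)) k rf nf _ w0 rh.
  rewrite -wE => /(_ (near_real_ray hs c0 sp0)).
  have -> : ((s * cos ps) +i* sin ps) ^+ k = (s ^+ k)%:C * cis (s * th).
    rewrite wE exprMn cisX rmorphXn /=; congr (_ * cis _).
    by rewrite -[LHS]mulr_natr -mulrA divfK // gt_eqF.
  have sV : s^-1 = s by apply: mulr1_eq.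
  rewrite invfM -cisN -fmorphV /= -exprVn sV.
  have bE : b = (Re b)%:C by case: (b) b0 => x y /= ->.
  rewrite -/b [X in Im (X * _)]bE !Im_realM /= sinN.
  have -> : sin (s * th) = s * sin th.
    by case: hs => ->; rewrite ?mul1r // !mulN1r sinN.
  by rewrite exprS; nra.
(* The sine is [1] at [pi / 2] and negative at [5 pi / 4]. *)
have h1 : 0 <= s ^+ k.+1 * Re b.
  by have := hth (pi / 2); rewrite sin_pihalf mulr1; apply; apply/andP; split; lra.
have h2 : s ^+ k.+1 * Re b <= 0.
  have s4 : 0 < sin (pi / 4 : R) by apply: sin_gt0_pi; apply/andP; split; lra.
  have := hth (pi / 4 + pi); rewrite sinDpi mulrN oppr_ge0 pmulr_lle0 //.
  by apply; apply/andP; split; lra.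
have : s ^+ k.+1 * Re b = 0 by apply/eqP; rewrite eq_le h1 h2.
move/eqP; rewrite mulf_eq0 expf_eq0 (negPf s0) andbF /= => /eqP rb.
by apply/eqP; rewrite eq_complex /= rb b0 !eqxx.
Qed.

(** The bisector [s + 'i] of the directions into [D] has square [2 s 'i], for
    which the sign condition reads [s b >= 0]. *)
Lemma real_double_residue_ge0 f s : s = 1 \/ s = -1 ->
  (forall z, 1 < nrm z -> regular z f) ->
  (forall z, 1 < nrm z -> 0 < Im z -> Im (rf_eval f z) <= 0) ->
  regular s%:C (('X - s%:C%:P)%:F ^+ 2 * f) ->
  0 <= s * Re (rf_eval (('X - s%:C%:P)%:F ^+ 2 * f) s%:C).
Proof.
move=> hs rf nf rh; set b := rf_eval _ _.
have s2 : s * s = 1 by case: hs => ->; ring.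
have w0 : (s * 1) +i* 1 != 0 :> C by rewrite eq_complex /= oner_eq0 andbF.
have := @Im_leading_coef_le0 f s%:C ((s * 1) +i* 1) 2 rf nf _ w0 rh.
move=> /(_ (near_real_ray hs ltr01 ltr01)).
have -> : ((s * 1) +i* 1) ^+ 2 = 0 +i* (2 * s) :> C.
  by apply/eqP; rewrite eq_complex expr2 /= !mulr1 s2 subrr eqxx /=; apply/eqP; ring.
rewrite Imc_div -/b; case: (b) => x y /=.
rewrite pmulr_lle0; first by lra.
rewrite invr_gt0; have -> : 0 ^+ 2 + (2 * s) ^+ 2 = 4%:R * (s * s) by ring.
by rewrite s2 mulr1 ltr0n.
Qed.

(** On the unit circle the Koebe term is real, so that the condition on the
    arc sees the simple pole only; near [s] the arc is vertical, and the sign of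
    [Im (a / (z - s))] is opposite to that of [a]. *)
Lemma real_residue_ge0 f h s a a2 : s = 1 \/ s = -1 -> 
  (forall z, nrm z = 1 -> 0 < Im z -> regular z f -> Im (rf_eval f z) <= 0) ->
  regular s%:C h -> rf_eval h s%:C = a%:C ->
  f = a2%:C%:P%:F * koebe F s%:C + (h / ('X - s%:C%:P)%:F) ->
  0 <= a.
Proof.
move=> hs cf rh eh fE.
have s2 : s * s = 1 by case: hs => ->; ring.
have s0 : s%:C != 0 :> C.
  by apply: contra_eq_neq s2 => /complexI ->; rewrite mul0r eq_sym oner_neq0.
have s0R : s != 0 by apply: contra_eq_neq s2 => ->; rewrite mul0r eq_sym oner_neq0.
have ns : nrm s%:C = 1 by rewrite /nrm /= expr0n addr0 expr2 s2 sqrtr1.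
(* The factor [s] in the parameter makes the path enter the upper half plane
   at [-1] too. *)
pose z (t : R) := cayley s%:C (s * t).
have FI : Filter (0 : R)^'+ by exact: filter_filter.
have t0 := @cvg_real0 R.
have hz : z t @[t --> (0 : R)^'+] --> (s%:C : C^o).
  have := @cvg_cayley C R (0 : R)^'+ FI (fun t => t%:C) s%:C (s%:C * 'i) t0.
  apply: cvg_trans; apply: near_eq_cvg; near=> t.
  by rewrite /z /cayley rmorphM /= [s%:C * t%:C]mulrC !mulrA.
have hne : \forall t \near (0 : R)^'+, z t != s%:C.
  apply: filterS (@nbhs_right_gt R 0) => t tp; apply: cayley_neq => //.
  by rewrite mulf_neq0 // gt_eqF.
have hrf := @near_regular C F R (0 : R)^'+ FI f z s%:C hz hne.
have hrh := @near_regularT C F R (0 : R)^'+ FI h z s%:C rh hz.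
have hh := @cvg_rf_eval C F R (0 : R)^'+ FI h z s%:C rh hz.
(* [u t] is [2 t / (z t - s)], extended by continuity to [t = 0]. *)
pose u (t : R) : C := - 'i * (1 + t%:C * (- 'i * s%:C)).
have hu : u t @[t --> (0 : R)^'+] --> (- 'i * 1 : C^o).
  apply: (@cvg_mull C R (0 : R)^'+ FI).
  exact: (@cvg_line C R (0 : R)^'+ FI (fun t => t%:C) 1 (- 'i * s%:C) t0).
have hp := @cvgM C R (0 : R)^'+ FI _ _ _ _ hh hu.
rewrite -oppr_le0; have -> : - a = Im (rf_eval h s%:C * (- 'i * 1)).
  by rewrite eh /=; ring.
apply: (@cvg_Im_le0 R R (0 : R)^'+ _ _ _ hp).
near=> t.
have tp : 0 < t by near: t; exact: nbhs_right_gt.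
have zne : z t != s%:C by near: t.
have rfz : regular (z t) f by near: t.
have rhz : regular (z t) h by near: t.
have nz : nrm (z t) = 1 by rewrite nrm_cayley.
have iz : 0 < Im (z t).
  rewrite /z /cayley Im_realM Imc_div.
  have -> : Im ((1 + (s * t)%:C * 'i) * conjc (1 - (s * t)%:C * 'i)) = s * t *+ 2.
    by rewrite /=; ring.
  rewrite mulrA -mulrnAr mulrA s2 mul1r divr_gt0 ?mulrn_wgt0 //.
  by rewrite -nrm_sqr exprn_gt0 // nrm_gt0 cayley_den.
have sJ : conjc s%:C = s%:C by rewrite /= oppr0.
have zneJ : z t != conjc s%:C by rewrite sJ.
have [rk _] := regular_koebe F zne zneJ.
have zne' : s%:C != z t by rewrite eq_sym.
have [rX eX] := regular_invX F zne'.
have := cf _ nz iz rfz; rewrite fE rf_evalD; last first.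
- exact: regularM.
- by apply: regularM => //; exact: regularP.
rewrite raddfD /= rf_evalM ?regularP // rf_evalC Im_realM koebe_Im_eq0 //.
rewrite mulr0 add0r rf_evalM // eX.
have uE : u t = (t *+ 2)%:C / (z t - s%:C).
  apply: (canRL (mulfK _)); first by rewrite subr_eq0.
  have D0 := cayley_den (s * t).
  apply: (mulIf D0); rewrite -mulrA mulrBl /z /cayley.
  rewrite -[s%:C * (_ / _) * _]mulrA divfK // /u.
  have SS : s%:C * s%:C = 1 :> C by rewrite -rmorphM s2.
  have ii : 'i * 'i = -1 :> C by exact: sqr_i.
  rewrite rmorphM rmorphMn /=.
  have gen (S q j : C) : S * S = 1 -> j * j = -1 ->
      - j * (1 + q * (- j * S)) * (S * (1 + S * q * j) - S * (1 - S * q * j)) =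
      q *+ 2 * (1 - S * q * j).
    move=> e1 e2.
    transitivity (- (j * j) * (S * S) * (q *+ 2) * (1 - S * q * j)); first by ring.
    by rewrite e1 e2 opprK !mul1r.
  exact: gen.
rewrite uE [X in _ -> Im X <= 0]mulrCA Im_realM => le0.
by rewrite mulr_ge0_le0 // mulrn_wge0 // ltW.
Unshelve. all: by end_near. Qed.

End ScalarNecessity.

(** * Quadratic forms of symmetric matrices *)

Section QuadraticForms.
Variables (R : realType) (m : nat).
Local Notation C := R[i].
Local Notation Im := (@complex.Im R).
Local Notation Re := (@complex.Re R).
Local Notation rc := (real_complex R).
Implicit Types (x y : 'I_m -> R).

Section Generic.
Variables (L : comPzRingType) (e : R -> L).
Implicit Types A B : 'M[L]_m.

(** The quadratic form at a real vector, in any ring that receives the reals;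
    it is used for matrices of numbers and of rational functions. *)
Definition qform x A : L := \sum_i \sum_j e (x i * x j) * A i j.

Lemma qformD x A B : qform x (A + B) = qform x A + qform x B.
Proof.
rewrite /qform -big_split /=; apply: eq_bigr => i _.
by rewrite -big_split /=; apply: eq_bigr => j _; rewrite mxE mulrDr.
Qed.

Lemma qformZ x c A : qform x (c *: A) = c * qform x A.
Proof.
rewrite /qform mulr_sumr; apply: eq_bigr => i _.
by rewrite mulr_sumr; apply: eq_bigr => j _; rewrite mxE mulrCA.
Qed.

Lemma qformN x A : qform x (- A) = - qform x A.
Proof. by rewrite -scaleN1r qformZ mulN1r. Qed.

Lemma qformB x A B : qform x (A - B) = qform x A - qform x B.
Proof. by rewrite qformD qformN. Qed.

End Generic.

Lemma sum_delta (B : 'M[R]_m) (y : 'I_m -> R) i :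
  \sum_k \sum_l (k == i)%:R * y l * B k l = \sum_l y l * B i l.
Proof.
rewrite (bigD1 i) //= [X in _ + X]big1 ?addr0.
  by apply: eq_bigr => l _; rewrite eqxx mul1r.
by move=> k /negPf ki; apply: big1 => l _; rewrite ki !mul0r.
Qed.

Lemma real_qform_eq0 (B : 'M[R]_m) : B^T = B ->
  (forall x, \sum_i \sum_j x i * x j * B i j = 0) -> B = 0.
Proof.
move=> Bs B0.
have s1 (y : 'I_m -> R) i : \sum_l (l == i)%:R * y l = y i.
  rewrite (bigD1 i) //= big1 ?addr0 ?eqxx ?mul1r //.
  by move=> l /negPf ->; rewrite mul0r.
have d i : B i i = 0.
  by rewrite -(B0 (fun k => (k == i)%:R)) sum_delta s1.
apply/matrixP => i j; rewrite mxE.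
have := B0 (fun k => (k == i)%:R + (k == j)%:R).
under eq_bigr => k _.
  under eq_bigr => l _ do rewrite mulrDl mulrDl.
  rewrite big_split /=.
  over.
rewrite big_split /= !sum_delta.
under eq_bigr => l _ do rewrite mulrDl.
rewrite big_split /= !s1.
under [X in _ + X]eq_bigr => l _ do rewrite mulrDl.
rewrite big_split /= !s1 !d.
have -> : B j i = B i j by rewrite -[in LHS]Bs mxE.
lra.
Qed.

Lemma Re_sum (I : Type) (r : seq I) (f : I -> C) :
  Re (\sum_(i <- r) f i) = \sum_(i <- r) Re (f i).
Proof. by elim: r => [|i r IH]; rewrite ?big_nil // !big_cons raddfD /= IH. Qed.

Lemma Im_sum (I : Type) (r : seq I) (f : I -> C) :
  Im (\sum_(i <- r) f i) = \sum_(i <- r) Im (f i).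
Proof. by elim: r => [|i r IH]; rewrite ?big_nil // !big_cons raddfD /= IH. Qed.

Lemma qform_Re x (A : 'M[C]_m) :
  Re (qform rc x A) = \sum_i \sum_j x i * x j * Re (A i j).
Proof.
rewrite /qform Re_sum; apply: eq_bigr => i _; rewrite Re_sum.
by apply: eq_bigr => j _; case: (A i j) => a b /=; rewrite mul0r subr0.
Qed.

Lemma qform_Im x (A : 'M[C]_m) :
  Im (qform rc x A) = \sum_i \sum_j x i * x j * Im (A i j).
Proof.
rewrite /qform Im_sum; apply: eq_bigr => i _; rewrite Im_sum.
by apply: eq_bigr => j _; rewrite Im_realM.
Qed.

Lemma qform_Im_eq0 (A : 'M[C]_m) : A^T = A ->
  (forall x, Im (qform rc x A) = 0) -> forall i j, Im (A i j) = 0.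
Proof.
move=> As A0 i j; pose B : 'M[R]_m := \matrix_(i, j) Im (A i j).
have -> : Im (A i j) = B i j by rewrite mxE.
rewrite (@real_qform_eq0 B) ?mxE //.
  by apply/matrixP => k l; rewrite !mxE -[in LHS]As mxE.
move=> x; apply: etrans (A0 x); rewrite qform_Im.
by apply: eq_bigr => k _; apply: eq_bigr => l _; rewrite mxE.
Qed.

(** Polarization, for the real and the imaginary part of [A] separately: [x]
    runs over real vectors only, but [A] is complex. *)
Lemma qform_eq0 (A : 'M[C]_m) : A^T = A ->
  (forall x, qform rc x A = 0) -> A = 0.
Proof.
move=> As A0; apply/matrixP => i j; rewrite mxE.
have i0 : Im (A i j) = 0 by apply: qform_Im_eq0 => // x; rewrite A0.
pose B : 'M[R]_m := \matrix_(i, j) Re (A i j).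
have r0 : Re (A i j) = B i j by rewrite mxE.
apply/eqP; rewrite eq_complex i0 r0 (@real_qform_eq0 B) ?mxE ?eqxx //.
  by apply/matrixP => k l; rewrite !mxE -[in LHS]As mxE.
move=> x; apply: etrans (congr1 Re (A0 x)); rewrite qform_Re.
by apply: eq_bigr => k _; apply: eq_bigr => l _; rewrite mxE.
Qed.

Lemma hform_mxE (v : 'cV[C]_m) (A : 'M[C]_m) :
  (v^t* *m A *m v) 0 0 = \sum_i \sum_j conjc (v i 0) * v j 0 * A i j.
Proof.
rewrite mxE [RHS]exchange_big /=; apply: eq_bigr => j _.
rewrite mxE mulr_suml; apply: eq_bigr => i _.
by rewrite !mxE mulrAC.
Qed.

Lemma psdmx_qform (A : 'M[C]_m) : psdmx A -> forall x, 0 <= qform rc x A.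
Proof.
move=> [_ A0] x; have := A0 (\col_i (x i)%:C); rewrite hform_mxE.
set S := (X in 0 <= X); suff -> : S = qform rc x A by [].
apply: eq_bigr => i _; apply: eq_bigr => j _.
by rewrite !mxE rmorphM /= oppr0.
Qed.

(** For a symmetric matrix the real quadratic form decides positive
    semidefiniteness: its values being real, the matrix is real, and then the
    Hermitian form at [u + iw] is the sum of the values at [u] and [w]. *)
Lemma psdmx_sym (A : 'M[C]_m) : A^T = A ->
  (forall x, 0 <= qform rc x A) -> psdmx A.
Proof.
move=> As A0.
have Aij i j : A j i = A i j by rewrite -[in LHS]As mxE.
have i0 : forall i j, Im (A i j) = 0.
  by apply: qform_Im_eq0 => // x; apply: ger0_Im.
split.
  apply/is_hermitianmxP; rewrite expr0 scale1r; apply/matrixP => i j.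
  by rewrite !mxE [A j i]Aij; apply/esym; exact: conjc_Im0.
move=> v; rewrite hform_mxE.
pose u i := Re (v i 0); pose w i := Im (v i 0).
suff -> : \sum_i \sum_j conjc (v i 0) * v j 0 * A i j = qform rc u A + qform rc w A.
  by rewrite addr_ge0.
set S := LHS.
(* Adding to the sum its transpose symmetrizes [conj (v i) * v j] into
   [2 (u i u j + w i w j)]. *)
have two : (2%:R : C) != 0 by rewrite pnatr_eq0.
apply: (mulfI two); rewrite mulr_natl mulr2n {2}/S exchange_big /=.
rewrite /S /qform -!big_split mulr_sumr /=; apply: eq_bigr => i _.
rewrite -!big_split mulr_sumr /=; apply: eq_bigr => j _.
rewrite Aij -!mulrDl mulrA; congr (_ * _).
rewrite /u /w; case: (v i 0) (v j 0) => a b [c d].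
by apply/eqP; rewrite eq_complex /=; apply/andP; split; apply/eqP; ring.
Qed.

Definition niform (E : 'M[C]_m) : 'M[C]_m := 'i%C *: (E - E^t*).

Lemma niform_sym (E : 'M[C]_m) : E^T = E -> (niform E)^T = niform E.
Proof.
move=> Es; have Eij i j : E j i = E i j by rewrite -[in LHS]Es mxE.
by apply/matrixP => i j; rewrite !mxE Eij.
Qed.

Lemma qform_niform x (E : 'M[C]_m) : E^T = E ->
  qform rc x (niform E) = (- (Im (qform rc x E) *+ 2))%:C.
Proof.
move=> Es; have Eij i j : E j i = E i j by rewrite -[in LHS]Es mxE.
rewrite qformZ qformB.
have -> : qform rc x (E^t*) = conjc (qform rc x E).
  rewrite /qform rmorph_sum /=; apply: eq_bigr => i _.
  rewrite rmorph_sum /=; apply: eq_bigr => j _.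
  by rewrite !mxE Eij [RHS]rmorphM /= oppr0.
case: (qform rc x E) => a b; apply/eqP; rewrite eq_complex /=.
by apply/andP; split; apply/eqP; ring.
Qed.

Lemma niform_ge0 (E : 'M[C]_m) : E^T = E ->
  loewner_le 0 (niform E) <-> forall x, Im (qform rc x E) <= 0.
Proof.
move=> Es; rewrite /loewner_le subr0.
have h x : (0 <= qform rc x (niform E)) = (Im (qform rc x E) <= 0).
  by rewrite qform_niform // lecR oppr_ge0 pmulrn_lle0.
split=> [/psdmx_qform A0 x|A0]; first by rewrite -h.
by apply: psdmx_sym => [|x]; [exact: niform_sym|rewrite h].
Qed.

Lemma niform_le0 (E : 'M[C]_m) : E^T = E ->
  (forall x, 0 <= Im (qform rc x E)) -> loewner_le (niform E) 0.
Proof.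
move=> Es h; rewrite /loewner_le sub0r; apply: psdmx_sym.
  by rewrite linearN /= niform_sym.
by move=> x; rewrite qformN qform_niform // -rmorphN opprK lecR mulrn_wge0.
Qed.

Lemma niform_eq0 (E : 'M[C]_m) : E^T = E ->
  (forall x, Im (qform rc x E) = 0) -> niform E = 0.
Proof.
move=> Es h; apply: qform_eq0; first exact: niform_sym.
by move=> x; rewrite qform_niform // h mul0rn oppr0.
Qed.

End QuadraticForms.

(** * Limits and derivatives of matrices of rational functions *)

Section MatrixLimits.

Lemma cvg_mxP (K : topologicalType) (m n : nat) (T : Type) (G : set_system T)
    (FG : Filter G) (h : T -> 'M[K]_(m, n)) (M : 'M[K]_(m, n)) :
  h @ G --> M <-> forall i j, h t i j @[t --> G] --> M i j.
Proof.
split=> [hM i j A nA|hM A [P nP sub]].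
  have : nbhs M [set N : 'M[K]_(m, n) | A (N i j)].
    exists (fun k l => if (k == i) && (l == j) then A else setT).
      move=> k l; case: ifP => [/andP[/eqP -> /eqP ->] //|_]; exact: filterT.
    by move=> N /(_ i j); rewrite !eqxx.
  by move=> /hM.
have : \forall t \near G, forall i j, P i j (h t i j).
  by apply: filter_forall => i; apply: filter_forall => j; exact: hM.
by apply: filterS => t Pt; apply: sub.
Qed.

Variables (K : numFieldType) (F : ratfun_field K) (m : nat).
Local Notation "p %:F" := (@rf_poly K F p) (at level 1, format "p %:F").
Implicit Types (G : 'M[F]_m) (z : K) (f : F).

Definition mx_eval G z : 'M[K]_m := map_mx (fun f => rf_eval f z) G.

Lemma cvg_shift z : (h + z) @[h --> (0 : K)^'] --> z.
Proof.
have FG : Filter ((0 : K)^') by exact: filter_filter.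
have H : h @[h --> (0 : K)^'] --> (0 : K).
  by move=> A nA; exact: (nbhs_dnbhs nA).
have := @cvg_line K K (0 : K)^' FG idfun z 1 H.
by under eq_fun do rewrite mulr1 addrC.
Qed.

(** The difference quotient is itself a rational function of [h + z],
    regular at [z], so that its limit is a value. *)
Lemma cvg_difference_quotient f z : regular z f ->
  h^-1 * (rf_eval f (h + z) - rf_eval f z) @[h --> (0 : K)^'] -->
  rf_eval ((f - (rf_eval f z)%:P%:F) / ('X - z%:P)%:F) z.
Proof.
move=> rz; set c := rf_eval f z; set g := _ / _.
have FG : Filter ((0 : K)^') by exact: filter_filter.
have rg : regular z g.
  apply: regular_divX; first by apply: regularB => //; exact: regularP.
  by rewrite rf_evalB ?regularP // rf_evalC subrr.
have X0 : ('X - z%:P)%:F != 0 by rewrite rf_poly_eq0 polyXsubC_eq0.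
have fE : f = ('X - z%:P)%:F * g + c%:P%:F.
  by rewrite /g mulrC divfK // subrK.
have hz := @cvg_shift z.
have := @cvg_rf_eval K F K (0 : K)^' FG g _ z rg hz.
apply: cvg_trans; apply: near_eq_cvg.
have rn := @near_regularT K F K (0 : K)^' FG g _ z rg hz.
apply: filterS2 rn (nbhs_dnbhs_neq (0 : K)) => h rgh h0.
have rX : regular (h + z) ('X - z%:P)%:F := regularP _ _ _.
have -> : rf_eval f (h + z) = h * rf_eval g (h + z) + c.
  rewrite [X in rf_eval X]fE rf_evalD ?regularP //; last exact: regularM.
  by rewrite rf_evalM // rf_evalC rf_evalP hornerXsubC addrK.
by rewrite addrK mulKf.
Qed.

Lemma derivable_mx_eval G z : (forall i j, regular z (G i j)) ->
  derivable (mx_eval G : K^o -> 'M[K^o]_m) z 1.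
Proof.
move=> rz; apply/cvg_ex.
exists (\matrix_(i, j) rf_eval ((G i j - (rf_eval (G i j) z)%:P%:F) / ('X - z%:P)%:F) z : 'M[K^o]_m).
apply/cvg_mxP => i j; rewrite mxE.
have := @cvg_difference_quotient _ _ (rz i j).
apply: cvg_trans; apply: near_eq_cvg.
apply: nearW => h /=; rewrite !mxE /=.
by rewrite /GRing.scale /= mulr1.
Qed.

(** A derivable function is continuous, so its product with the denominator,
    which is the numerator, tends to [0] at a root of the denominator; this
    contradicts coprimality. *)
Lemma regular_of_derivable G z i j :
  derivable (mx_eval G : K^o -> 'M[K^o]_m) z 1 -> regular z (G i j).
Proof.
move=> /cvg_ex[L] /cvg_mxP/(_ i j); set f := G i j.
have PG : ProperFilter ((0 : K)^') by exact: Proper_dnbhs_numFieldType.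
have FG : Filter ((0 : K)^') by exact: filter_filter.
move=> hL; apply/negP => dz.
have h0 : h @[h --> (0 : K)^'] --> (0 : K).
  by move=> A nA; exact: (nbhs_dnbhs nA).
have hz := @cvg_shift z.
have hd := @cvg_horner K K (0 : K)^' FG (rf_den f) _ _ hz.
have hn := @cvg_horner K K (0 : K)^' FG (rf_num f) _ _ hz.
have h1 : rf_eval f (h + z) @[h --> (0 : K)^'] --> 0 * L i j + rf_eval f z.
  have h2 := @cvgM K K (0 : K)^' FG _ _ _ _ h0 hL.
  have h3 := @cvg_line K K (0 : K)^' FG (fun h => h * (h^-1 * (rf_eval f (h + z) - rf_eval f z))) (rf_eval f z) 1.
  rewrite mul0r add0r; have : h * (h^-1 * (rf_eval f (h + z) - rf_eval f z)) @[h --> (0 : K)^'] --> (0 : K).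
    rewrite -[X in _ --> X](mul0r (L i j)).
    apply: cvg_trans h2; apply: near_eq_cvg; apply: nearW => h /=.
    by rewrite !mxE /= /GRing.scale /= mulr1.
  move=> /h3; apply: cvg_trans; apply: near_eq_cvg.
  apply: filterS (nbhs_dnbhs_neq (0 : K)) => h hn0 /=.
  by rewrite mulr1 mulVKf // addrC subrK.
have h2 := @cvgM K K (0 : K)^' FG _ _ _ _ h1 hd.
have hne : \forall h \near (0 : K)^', h + z != z.
  apply: filterS (nbhs_dnbhs_neq (0 : K)) => h hn0.
  by rewrite -subr_eq0 addrK.
have hreg := @near_regular K F K (0 : K)^' FG f _ _ hz hne.
have h3 : (rf_num f).[h + z] @[h --> (0 : K)^'] --> (0 : K).
  move: h2; rewrite (eqP dz) mulr0; apply: cvg_trans; apply: near_eq_cvg.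
  by apply: filterS hreg => h rh /=; rewrite /rf_eval divfK.
have n0 : (rf_num f).[z] = 0.
  exact: (@cvg_unique K^o (@norm_hausdorff K K^o) _ (fmap_proper_filter _ PG) _ _ hn h3).
have := rf_coprime f; rewrite coprimep_sym => /coprimep_root/(_ dz).
by rewrite n0 eqxx.
Qed.

End MatrixLimits.

(** * Poles and quadratic forms of transfer matrices *)

Section TransferMatrices.
Variables (R : realType) (m : nat).
Local Notation C := R[i].
Local Notation Im := (@complex.Im R).
Local Notation Re := (@complex.Re R).
Local Notation rc := (real_complex R).
Variable F : ratfun_field C.
Local Notation "p %:F" := (@rf_poly C F p) (at level 1, format "p %:F").
Implicit Types (G : 'M[F]_m) (A : 'M[C]_m) (z p : C) (x : 'I_m -> R) (k : nat).

Definition mx_order G p : nat :=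
  (\max_(i < m) \max_(j < m) mup p (rf_den (G i j)))%N.

Definition mx_const A : 'M[F]_m := map_mx (fun c => c%:P%:F) A.

Definition mx_regular z G := forall i j, regular z (G i j).

Lemma mx_order_leP G p k :
  (mx_order G p <= k)%N <-> mx_regular p (('X - p%:P)%:F ^+ k *: G).
Proof.
split=> [le i j|rk].
  rewrite mxE; apply/mup_den_leP; apply: leq_trans le.
  apply: leq_trans (@leq_bigmax _ (fun i => \max_(j < m) mup p (rf_den (G i j)))%N i).
  exact: (@leq_bigmax _ (fun j => mup p (rf_den (G i j))) j).
apply/bigmax_leqP => i _; apply/bigmax_leqP => j _.
by apply/mup_den_leP; have := rk i j; rewrite mxE.
Qed.

Lemma mx_order_eq0P G p : ~ (0 < mx_order G p)%N <-> mx_regular p G.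
Proof.
rewrite -[G in mx_regular _ G]scale1r -(expr0 ('X - p%:P)%:F) -mx_order_leP leqn0.
by rewrite lt0n; split=> [/negP|/eqP ->]; rewrite ?negbK // eqxx.
Qed.

Lemma mx_order_attained G p k : mx_order G p = k -> (0 < k)%N ->
  exists i j, rf_eval (('X - p%:P)%:F ^+ k * G i j) p != 0.
Proof.
move=> ok k0.
have [|no] := pselect (exists i j, (k <= mup p (rf_den (G i j)))%N).
  move=> [i [j kle]]; exists i, j; apply: eval_pole_neq0 => //.
  apply/eqP; rewrite eqn_leq kle andbT -ok.
  apply: leq_trans (@leq_bigmax _ (fun i => \max_(j < m) mup p (rf_den (G i j)))%N i).
  exact: (@leq_bigmax _ (fun j => mup p (rf_den (G i j))) j).
exfalso; suff : (mx_order G p <= k.-1)%N by rewrite ok -ltnS prednK // ltnn.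
apply/bigmax_leqP => i _; apply/bigmax_leqP => j _.
rewrite -ltnS prednK // ltnNge; apply/negP => kle.
by apply: no; exists i, j.
Qed.

Definition rcst (r : R) : F := r%:C%:P%:F.

Lemma mx_eval_tr G z : (mx_eval G z)^T = mx_eval G^T z.
Proof. by rewrite /mx_eval map_trmx. Qed.

Lemma qform_eval x G z : mx_regular z G ->
  regular z (qform rcst x G) /\
  rf_eval (qform rcst x G) z = qform rc x (mx_eval G z).
Proof.
move=> rz; have h i j : regular z (rcst (x i * x j) * G i j) /\
    rf_eval (rcst (x i * x j) * G i j) z = (x i * x j)%:C * mx_eval G z i j.
  have rC : regular z (rcst (x i * x j)) := regularP _ _ _.
  by split; [exact: regularM|rewrite rf_evalM // rf_evalC mxE].
have hi i : regular z (\sum_j rcst (x i * x j) * G i j) /\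
    rf_eval (\sum_j rcst (x i * x j) * G i j) z = \sum_j (x i * x j)%:C * mx_eval G z i j.
  have [r e] := @regular_sum _ F z _ (index_enum _) (fun j => rcst (x i * x j) * G i j) (fun j => (h i j).1).
  by split=> //; rewrite e; apply: eq_bigr => j _; exact: (h i j).2.
have [r e] := @regular_sum _ F z _ (index_enum _) _ (fun i => (hi i).1).
by split=> //; rewrite e; apply: eq_bigr => i _; exact: (hi i).2.
Qed.

Lemma qform_real x G : (forall i j, rf_real (G i j)) -> rf_real (qform rcst x G).
Proof.
move=> rG; apply: rf_real_sum => i; apply: rf_real_sum => j.
by apply: rf_realM => //; exact: rf_realC.
Qed.

Lemma qform_const x A : qform rcst x (mx_const A) = (qform rc x A)%:P%:F.
Proof.
rewrite /qform !rmorph_sum /=; apply: eq_bigr => i _.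
rewrite !rmorph_sum /=; apply: eq_bigr => j _.
by rewrite mxE /rcst -rmorphM -polyCM.
Qed.

Lemma cvg_sumC (T : Type) (B : set_system T) (FB : Filter B) (I : Type)
    (r : seq I) (h : I -> T -> C^o) (l : I -> C^o) :
  (forall i, h i t @[t --> B] --> l i) ->
  \sum_(i <- r) h i t @[t --> B] --> \sum_(i <- r) l i.
Proof.
move=> hl; elim: r => [|i r IH].
  under eq_fun do rewrite big_nil.
  by rewrite big_nil; exact: cvg_cst.
under eq_fun do rewrite big_cons.
by rewrite big_cons; apply: (@cvgD C C^o T B FB); [exact: hl|exact: IH].
Qed.

Lemma cvg_realV_infty : (t%:C)^-1 @[t --> (0 : R)^'+] --> @infty R.
Proof.
move=> P /near_inftyP[M MP].
have : \forall t \near (0 : R)^'+, t < (`|M| + 1)^-1.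
  by apply: nbhs_right_lt; rewrite invr_gt0 ltr_wpDl.
apply: filterS2 (@nbhs_right_gt R 0) => t t0 tM.
apply: MP; rewrite nrmV.
have -> : nrm t%:C = t by rewrite /nrm /= expr0n addr0 sqrtr_sqr ger0_norm // ltW.
apply: le_lt_trans (ler_norm M) _; apply: lt_trans (_ : `|M| + 1 < _); first by rewrite ltrDl.
by rewrite -[X in X < _]invrK ltf_pV2 // posrE ?invr_gt0 // ltr_wpDl.
Qed.

(** The value at infinity of a real function is real, since it can be
    approached along the real axis. *)
Lemma proper_decays x G (L : 'M[C^o]_m) : (forall i j, rf_real (G i j)) ->
  (forall z, 1 < nrm z -> mx_regular z G) ->
  (mx_eval G w^-1 : 'M[C^o]_m) @[w --> (0 : C^o)^'] --> L ->
  decays (qform rcst x G).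
Proof.
move=> rG oG /cvg_mxP hL; set f := qform rcst x G.
have FI : Filter (@infty R) by exact: filter_filter.
have hE i j : mx_eval G z i j @[z --> @infty R] --> L i j by exact: hL.
have hq : qform rc x (mx_eval G z) @[z --> @infty R] --> (qform rc x (L : 'M[C]_m) : C^o).
  apply: cvg_sumC => i; apply: cvg_sumC => j.
  exact: (@cvg_mull C _ (@infty R) FI _ (x i * x j)%:C _ (hE i j)).
have hf : rf_eval f z @[z --> @infty R] --> (qform rc x (L : 'M[C]_m) : C^o).
  apply: cvg_trans hq; apply: near_eq_cvg; apply/near_inftyP; exists 1 => z nz.
  by have [_ ->] := qform_eval x (oG z nz).
have hI := @cvg_Im R C^o (@infty R) FI _ _ hf.
suff e0 : Im (qform rc x (L : 'M[C]_m)) = 0 by rewrite /decays -e0.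
have FP : ProperFilter ((0 : R)^'+) by exact: at_right_proper_filter.
have FR : Filter ((0 : R)^'+) by exact: filter_filter.
have hr : Im (rf_eval f (t%:C)^-1) @[t --> (0 : R)^'+] -->
    Im (qform rc x (L : 'M[C]_m)).
  by move=> A /hI /cvg_realV_infty.
have h0 : Im (rf_eval f (t%:C)^-1) @[t --> (0 : R)^'+] --> (0 : R).
  apply: cvg_trans (@cvg_cst R 0 R (0 : R)^'+ FR); apply: near_eq_cvg.
  have : \forall t \near (0 : R)^'+, 1 < nrm (t%:C)^-1.
    have H : \forall z \near @infty R, 1 < nrm z by apply/near_inftyP; exists 1.
    by move: H => /cvg_realV_infty.
  apply: filterS => t nt; apply/esym/rf_real_Im0; first exact: qform_real.
    by have [] := qform_eval x (oG _ nt).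
  by rewrite -fmorphV.
exact: (@cvg_unique R (@Rhausdorff R) _ (fmap_proper_filter _ FP) _ _ hr h0).
Qed.

End TransferMatrices.

(** * The criterion for matrices *)

Section MatrixCriterion.
Variables (R : realType) (m : nat).
Local Notation C := R[i].
Local Notation Im := (@complex.Im R).
Local Notation Re := (@complex.Re R).
Local Notation rc := (real_complex R).
Variable F : ratfun_field C.
Local Notation "p %:F" := (@rf_poly C F p) (at level 1, format "p %:F").
Local Notation "'Xs' z" := (('X - z%:P)%:F) (at level 0, z at level 0).
Local Notation rcst := (@rcst R F).
Implicit Types (A : 'M[C]_m) (z p : C) (x : 'I_m -> R) (k : nat) (s : R).
Variable G : 'M[F]_m.
Hypothesis Gsym : G^T = G.
Hypothesis Greal : forall i j, rf_real (G i j).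

Lemma Xs_neq0 z : Xs z != 0 :> F.
Proof. by rewrite rf_poly_eq0 polyXsubC_eq0. Qed.

Lemma qform_eval_scale x (c : F) z : mx_regular z (c *: G) ->
  regular z (c * qform rcst x G) /\
  rf_eval (c * qform rcst x G) z = qform rc x (mx_eval (c *: G) z).
Proof. by rewrite -qformZ; exact: qform_eval. Qed.

Lemma koebe_at_real s : s = 1 \/ s = -1 ->
  koebe F s%:C = (Xs (s%:C))^-1 + s%:C%:P%:F * (Xs (s%:C))^-1 ^+ 2.
Proof.
move=> hs; have sJ : conjc s%:C = s%:C by rewrite /= oppr0.
rewrite /koebe sJ [in X in _ / X]rmorphM invfM.
have -> : 'X%:F = Xs (s%:C) + s%:C%:P%:F by rewrite -rmorphD subrK.
by rewrite mulrDl mulrA divff ?Xs_neq0 // mul1r expr2.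
Qed.

(** The values and residues of [x^T G x] are those of [G], evaluated by the
    quadratic form.  The weights of the Koebe terms are chosen to cancel the
    poles: [2 Im z K] for the normalized residue [K] at a point [z] of the arc,
    and [s x^T A2 x] at [s = 1] or [s = -1], where the Koebe term
    [1 / (z - s) + s / (z - s)^2] leaves the simple pole with residue
    [x^T (A1 - s A2) x]. *)
Theorem ni_of_boundary :
  (forall z, 1 < nrm z -> mx_regular z G) ->
  (forall x, decays (qform rcst x G)) ->
  (forall z, nrm z = 1 -> 0 < Im z -> mx_regular z G ->
     forall x, Im (qform rc x (mx_eval G z)) <= 0) ->
  (forall z, nrm z = 1 -> 0 < Im z -> ~ mx_regular z G ->
     mx_regular z (Xs z *: G) /\
     forall x, 0 <= qform rc x (z^-1 *: ('i%C *: mx_eval (Xs z *: G) z))) ->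
  (forall s, s = 1 \/ s = -1 -> ~ mx_regular s%:C G ->
     exists A1 A2, [/\ mx_regular s%:C
        (G - (Xs (s%:C))^-1 *: mx_const F A1 - (Xs (s%:C))^-1 ^+ 2 *: mx_const F A2),
        forall x, 0 <= s%:C * qform rc x A2 &
        forall x, 0 <= qform rc x A1 - s%:C * qform rc x A2]) ->
  forall x z, 1 < nrm z -> 0 < Im z -> Im (rf_eval (qform rcst x G) z) <= 0.
Proof.
move=> oG dG cG pG sG x; set f := qform rcst x G.
have rlf : rf_real f by exact: qform_real.
have FR : Filter ((0 : R)^'+) by exact: filter_filter.
apply: scalar_sufficiency => //.
- exact: dG.
- by move=> z nz; have [] := qform_eval x (oG z nz).
- move=> z nz iz rz.
  (* A pole of [G] at [z] may disappear in the quadratic form; then the sign is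
     obtained as a limit along the arc. *)
  have z0 : z != 0 by rewrite -nrm_gt0 nz.
  have hz := @cvg_cayley0 R z.
  have hne : \forall t \near (0 : R)^'+, cayley z t != z.
    apply: filterS (@nbhs_right_gt R 0) => t t0.
    by apply: cayley_neq => //; rewrite gt_eqF.
  have hreg : \forall t \near (0 : R)^'+, mx_regular (cayley z t) G.
    apply: filter_forall => i; apply: filter_forall => j.
    exact: (@near_regular C F R (0 : R)^'+ FR (G i j) (cayley z) z hz hne).
  have hIm := @cvg_Im R R (0 : R)^'+ FR (cayley z) z hz.
  have hpos := @cvgr_gt R R (0 : R)^'+ FR _ _ hIm 0 iz.
  have hf := @cvg_rf_eval C F R (0 : R)^'+ FR f (cayley z) z rz hz.
  apply: (@cvg_Im_le0 R R (0 : R)^'+ _ _ _ hf).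
  apply: filterS2 hpos hreg => t ipos rt.
  have [_ ->] := qform_eval x rt.
  by apply: cG => //; rewrite nrm_cayley.
- move=> z nz iz; have [rz|nrz] := pselect (mx_regular z G).
    exists 0 => //; rewrite !rmorph0 mul0r subr0.
    by have [] := qform_eval x rz.
  have [rX psd] := pG z nz iz nrz.
  have [rXf eXf] := qform_eval_scale x rX; rewrite -/f in rXf eXf.
  have := psd x; rewrite !qformZ -eXf; set b := rf_eval _ _ => K0.
  pose K := Re (z^-1 * ('i%C * b)).
  have KE : z^-1 * ('i%C * b) = K%:C by rewrite RRe_real // ger0_real.
  have K0' : 0 <= K by move: K0; rewrite KE ler0c.
  exists (2 * Im z * K); first by rewrite !mulr_ge0 // ltW.
  have z0 : z != 0 by rewrite -nrm_gt0 nz.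
  have zJ : z != conjc z.
    apply: contraTneq iz => zE; have : Im z = - Im z by rewrite {1}zE; case: (z).
    by move=> e; rewrite -leNgt; lra.
  set k := 2 * Im z * K.
  have zJ' : conjc z != z by rewrite eq_sym.
  have [rJ eJ] := regular_invX F zJ'.
  pose g := Xs z * f - rcst k * ('X%:F * (Xs (conjc z))^-1).
  have rk : regular z (rcst k) := regularP _ _ _.
  have rx : regular z ('X%:F : F) := regularP _ _ _.
  have rxJ := regularM rx rJ.
  have rkxJ := regularM rk rxJ.
  have rg : regular z g := regularB rXf rkxJ.
  have eg : rf_eval g z = 0.
    rewrite /g (rf_evalB rXf rkxJ) (rf_evalM rk rxJ) (rf_evalM rx rJ).
    rewrite eJ !rf_evalP hornerC hornerX -/b.
    have -> : z - conjc z = (2 * Im z)%:C * 'i%C.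
      by case: (z) => a c /=; apply/eqP; rewrite eq_complex /=; apply/andP; split; apply/eqP; ring.
    have ii : 'i%C * 'i%C = -1 :> C by exact: sqr_i.
    have bE : b = - 'i%C * z * K%:C.
      rewrite -KE; transitivity (- ('i%C * 'i%C) * (z / z) * b); last by ring.
      by rewrite ii opprK mul1r divff // mul1r.
    have gen (a q j : C) : a != 0 -> j * j = -1 ->
        - j * z * q - a * q * (z / (a * j)) = 0.
      move=> a0 jj; have -> : (a * j)^-1 = a^-1 * - j.
        by rewrite invfM; congr (_ * _); apply: mulr1_eq; rewrite mulrN jj opprK.
      by field.
    rewrite bE /k rmorphM /=; apply: gen => //.
    by rewrite eq_complex /= eqxx andbT mulf_neq0 // gt_eqF.
  have -> : f - rcst k * koebe F z = g / Xs z.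
    have e1 : Xs z * f / Xs z = f by rewrite mulrC mulKf ?Xs_neq0.
    rewrite /g /koebe [RHS]mulrBl e1; congr (_ - _).
    by rewrite (rmorphM (@rf_poly C F)) invfM mulrA; ring.
  exact: regular_divX.
move=> s hs; have [rz|nrz] := pselect (mx_regular s%:C G).
  exists 0, 0; split=> //; rewrite /simple_pole !rmorph0 !mul0r !subr0.
  by have [] := qform_eval x rz.
have [A1 [A2 [rG1 p2 p1]]] := sG s hs nrz.
have s2 : s * s = 1 by case: hs => ->; ring.
pose kC := s%:C * qform rc x A2; pose aC := qform rc x A1 - kC.
have kE : kC = (Re kC)%:C by rewrite RRe_real // ger0_real // p2.
have aE : aC = (Re aC)%:C by rewrite RRe_real // ger0_real // p1.
exists (Re kC), (Re aC); split.
- by have := p2 x; rewrite -/kC kE ler0c.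
- by have := p1 x; rewrite -/kC -/aC aE ler0c.
have [r1 _] := qform_eval x rG1.
move: r1; rewrite !qformB !qformZ !qform_const -/f.
rewrite -[((Re kC)%:C%:P)]/((Re kC)%:C%:P) -kE /simple_pole -aE koebe_at_real //.
have A2E : qform rc x A2 = s%:C * kC by rewrite /kC mulrA -rmorphM s2 mul1r.
have A1E : qform rc x A1 = aC + kC by rewrite /aC subrK.
rewrite A2E A1E polyCM polyCD !rmorphM !rmorphD.
congr (regular _ _); ring.
Qed.

Section Necessity.
Hypothesis oG : forall z, 1 < nrm z -> mx_regular z G.
Hypothesis nG : forall x z, 1 < nrm z -> 0 < Im z ->
  Im (rf_eval (qform rcst x G) z) <= 0.

Let oQ x z : 1 < nrm z -> regular z (qform rcst x G).
Proof. by move=> nz; have [] := qform_eval x (oG nz). Qed.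

Lemma arc_Im_le0 z x : nrm z = 1 -> 0 < Im z ->
  regular z (qform rcst x G) -> Im (rf_eval (qform rcst x G) z) <= 0.
Proof.
move=> nz iz rf.
have z0 : z != 0 by rewrite -nrm_gt0 nz.
have z1 : z * 1 != 0 by rewrite mulr1.
have rf0 : regular z (Xs z ^+ 0 * qform rcst x G) by rewrite expr0 mul1r.
have := @Im_leading_coef_le0 R F (qform rcst x G) z (z * 1) 0 (oQ x) (nG x) _ z1 rf0.
rewrite !expr0 mul1r divr1; apply; exact: near_arc_ray.
Qed.

Lemma symmxZ (L : comNzRingType) (n : nat) (c : L) (B : 'M[L]_n) :
  B^T = B -> (c *: B)^T = c *: B.
Proof. by move=> Bs; rewrite linearZ /= Bs. Qed.

Lemma mx_eval_scale_sym (c : F) z : (mx_eval (c *: G) z)^T = mx_eval (c *: G) z.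
Proof. by rewrite mx_eval_tr symmxZ. Qed.

(** At the exact order of the pole the leading coefficient matrix is nonzero,
    whereas its quadratic form vanishes if that order is at least [2]. *)
Lemma mx_order_arc z : nrm z = 1 -> 0 < Im z -> (mx_order G z <= 1)%N.
Proof.
move=> nz iz; rewrite leqNgt; apply/negP => k2.
set k := mx_order G z in k2.
have rk : mx_regular z (Xs z ^+ k *: G) by apply/mx_order_leP.
suff e0 : mx_eval (Xs z ^+ k *: G) z = 0.
  have [i [j]] := @mx_order_attained R m F G z k erefl (ltnW k2).
  by move/matrixP/(_ i j): e0; rewrite !mxE => ->; rewrite eqxx.
apply: qform_eq0 => [|x]; first exact: mx_eval_scale_sym.
have [rQ <-] := qform_eval_scale x rk.
by apply: arc_pole_simple => //; [exact: oQ|exact: nG].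
Qed.

Lemma arc_residue_psd z : nrm z = 1 -> 0 < Im z ->
  psdmx (z^-1 *: ('i%C *: mx_eval (Xs z *: G) z)).
Proof.
move=> nz iz.
have rk : mx_regular z (Xs z *: G).
  by rewrite -[Xs z]expr1; apply/mx_order_leP; exact: mx_order_arc.
apply: psdmx_sym => [|x]; first by do 2! apply: symmxZ; exact: mx_eval_scale_sym.
have [rQ eQ] := qform_eval_scale x rk.
rewrite !qformZ -eQ.
by apply: arc_residue_ge0 => //; [exact: oQ|exact: nG].
Qed.

Lemma rf_real_Xs s : rf_real (Xs (s%:C) : F).
Proof. exact: rf_real_XsubC. Qed.

Lemma mx_order_real s : s = 1 \/ s = -1 -> (mx_order G s%:C <= 2)%N.
Proof.
move=> hs; rewrite leqNgt; apply/negP => k3.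
set k := mx_order G s%:C in k3.
have rk : mx_regular s%:C (Xs (s%:C) ^+ k *: G) by apply/mx_order_leP.
suff e0 : mx_eval (Xs (s%:C) ^+ k *: G) s%:C = 0.
  have [i [j]] := @mx_order_attained R m F G s%:C k erefl (ltn_trans (isT : 0 < 2)%N k3).
  by move/matrixP/(_ i j): e0; rewrite !mxE => ->; rewrite eqxx.
apply: qform_eq0 => [|x]; first exact: mx_eval_scale_sym.
have [rQ <-] := qform_eval_scale x rk.
apply: real_pole_order_le2 => //; [exact: qform_real|exact: oQ|exact: nG].
Qed.

Lemma real_hermsym A : A^T = A -> (forall i j, Im (A i j) = 0) -> A \is hermsymmx.
Proof.
move=> As A0; apply/is_hermitianmxP; rewrite expr0 scale1r; apply/matrixP => i j.
by rewrite !mxE -[in LHS]As mxE; apply/esym; exact: conjc_Im0.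
Qed.

(** The residues are built from the top: [A2] is the value of
    [(X - s)^2 G], and [A1] that of what remains after subtracting [A2]. *)
Lemma real_pole_residues s : s = 1 \/ s = -1 ->
  exists A1 A2, [/\ mx_regular s%:C
        (G - (Xs (s%:C))^-1 *: mx_const F A1 - (Xs (s%:C))^-1 ^+ 2 *: mx_const F A2),
      A1 \is hermsymmx, A2 \is hermsymmx,
      psdmx (s%:C *: A2) & psdmx (A1 - s%:C *: A2)].
Proof.
move=> hs; pose X := Xs (s%:C) : F.
have s2 : s * s = 1 by case: hs => ->; ring.
have X0 : X != 0 by exact: Xs_neq0.
have rlX : rf_real X by exact: rf_real_Xs.
have rlXV : rf_real X^-1 by exact: rf_real_invX.
have r2 : mx_regular s%:C (X ^+ 2 *: G) by apply/mx_order_leP; exact: mx_order_real.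
pose A2 := mx_eval (X ^+ 2 *: G) s%:C.
have A2s : A2^T = A2 by exact: mx_eval_scale_sym.
have rlG2 i j : rf_real ((X ^+ 2 *: G) i j).
  by rewrite mxE; apply: rf_realM => //; rewrite expr2; exact: rf_realM.
have A2r i j : Im (A2 i j) = 0 by rewrite mxE; apply: rf_real_Im0.
have A2E i j : A2 i j = (Re (A2 i j))%:C by case: (A2 i j) (A2r i j) => a c /= ->.
pose H1 : 'M[F]_m := X^-1 *: (X ^+ 2 *: G - mx_const F A2).
have r1 : mx_regular s%:C H1.
  move=> i j; rewrite mxE mulrC; apply: regular_divX.
    by rewrite !mxE; apply: regularB; [have := r2 i j; rewrite mxE|exact: regularP].
  rewrite !mxE rf_evalB ?regularP //; last by have := r2 i j; rewrite mxE.
  by rewrite rf_evalC ?mxE subrr.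
have rlH1 i j : rf_real (H1 i j).
  rewrite mxE; apply: rf_realM => //; rewrite mxE; apply: rf_realD => //.
  by rewrite mxE; apply: rf_realN; rewrite mxE A2E; exact: rf_realC.
pose A1 := mx_eval H1 s%:C.
have H1s : H1^T = H1.
  by apply: symmxZ; rewrite linearB /= symmxZ // /mx_const map_trmx A2s.
have A1s : A1^T = A1 by rewrite mx_eval_tr H1s.
have A1r i j : Im (A1 i j) = 0 by rewrite mxE; apply: rf_real_Im0.
have A1E i j : A1 i j = (Re (A1 i j))%:C by case: (A1 i j) (A1r i j) => a c /= ->.
have GE : G = X^-1 *: H1 + X^-1 ^+ 2 *: mx_const F A2.
  rewrite /H1 scalerA -expr2 scalerBr scalerA -exprMn mulVf // expr1n scale1r.
  by rewrite subrK.
have psd2 : psdmx (s%:C *: A2).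
  apply: psdmx_sym => [|x]; first exact: symmxZ.
  have [rQ eQ] := qform_eval_scale x r2.
  rewrite qformZ -eQ; have h := real_double_residue_ge0 hs (oQ x) (nG x) rQ.
  have rlQ : rf_real (X ^+ 2 * qform rcst x G).
    by apply: rf_realM; [rewrite expr2; exact: rf_realM|exact: qform_real].
  have i0 : Im (rf_eval (X ^+ 2 * qform rcst x G) s%:C) = 0 by exact: rf_real_Im0.
  rewrite lecE Im_realM i0 mulr0 eqxx /=.
  by move: h i0; case: (rf_eval _ _) => a c /= h ->; rewrite mulr0 subr0.
exists A1, A2; split; [|exact: real_hermsym|exact: real_hermsym|exact: psd2|].
  have -> : G - X^-1 *: mx_const F A1 - X^-1 ^+ 2 *: mx_const F A2 =
     X^-1 *: (H1 - mx_const F A1).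
    by rewrite {1}GE addrAC addrK scalerBr.
  move=> i j; rewrite mxE mulrC; apply: regular_divX.
    rewrite mxE; apply: regularD; first exact: r1.
    by rewrite mxE; apply: regularN; rewrite mxE; exact: regularP.
  have r1' : regular s%:C (H1 i j) by exact: r1.
  rewrite [X in rf_eval X]mxE [X in rf_eval (_ + X)]mxE [X in rf_eval (_ - X)]mxE.
  have A1ij : A1 i j = rf_eval (H1 i j) s%:C by rewrite [LHS]mxE.
  by rewrite rf_evalB ?regularP // rf_evalC A1ij subrr.
apply: psdmx_sym => [|x]; first by rewrite linearB /= linearZ /= A1s A2s.
rewrite qformB qformZ.
have [rH eH] := qform_eval x r1.
have iA1 : Im (qform rc x A1) = 0 by rewrite -eH; apply: rf_real_Im0 => //; exact: qform_real.
have iA2 : Im (qform rc x A2) = 0.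
  rewrite qform_Im big1 // => i _; rewrite big1 // => j _; by rewrite A2r mulr0.
pose c2 := s * Re (qform rc x A2).
have c2E : s%:C * qform rc x A2 = c2%:C.
  rewrite /c2 rmorphM /=; congr (_ * _).
  by case: (qform rc x A2) iA2 => a c /= ->.
have A2q : qform rc x A2 = s%:C * c2%:C.
  by rewrite -c2E; move: (qform rc x A2) => q; rewrite mulrA -rmorphM s2 mul1r.
pose a := Re (qform rc x A1) - c2.
have aE : qform rc x A1 - c2%:C = a%:C.
  rewrite /a rmorphB /=; congr (_ - _).
  by case: (qform rc x A1) iA1 => u v /= ->.
rewrite c2E aE ler0c.
pose h := qform rcst x H1 - c2%:C%:P%:F.
apply: (@real_residue_ge0 R F (qform rcst x G) h s a c2 hs).
- by move=> z; exact: arc_Im_le0.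
- by apply: regularB => //; exact: regularP.
- by rewrite rf_evalB ?regularP // eH rf_evalC aE.
rewrite koebe_at_real // [in LHS]GE qformD (qformZ rcst x X^-1 H1).
rewrite (qformZ rcst x (X^-1 ^+ 2) (mx_const F A2)) (qform_const F x A2) A2q.
by rewrite polyCM rmorphM /h -/X; ring.
Qed.

End Necessity.

End MatrixCriterion.

(** * Discrete-time negative imaginary systems *)

Section DiscreteNegativeImaginary.
Variables (R : realType) (m : nat).
Local Notation C := R[i].
Local Notation Im := (@complex.Im R).
Local Notation Re := (@complex.Re R).
Local Notation rc := (real_complex R).
Variable F : ratfun_field C.
Local Notation "p %:F" := (@rf_poly C F p) (at level 1, format "p %:F").
Implicit Types (G : 'M[F]_m) (A : 'M[C]_m) (z p : C) (x : 'I_m -> R) (s : R).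

Definition mx_analytic_on (U : set C^o) G : Prop :=
  forall z, U z -> derivable (mx_eval G : C^o -> 'M[C^o]_m) z 1.

Definition mx_has_residues G p A1 A2 : Prop :=
  let u := (('X - p%:P)%:F)^-1 in
  exists2 G1 : 'M[F]_m,
    G = G1 + u *: mx_const F A1 + (u ^+ 2) *: mx_const F A2 &
    exists2 U : set C^o, open_nbhs (p : C^o) U & mx_analytic_on U G1.

Definition mx_normalized_residual G p : 'M[C]_m :=
  p^-1 *: (lim (((z - p) *: ('i%C *: mx_eval G z) : 'M[C^o]_m)
                 @[z --> (p : C^o)^']) : 'M[C]_m).

(** The analytic remainder [G1] is determined by the residues, and being
    analytic near [p] amounts to having no pole at [p], because poles are
    isolated. *)
Lemma mx_has_residuesP G p A1 A2 : mx_has_residues G p A1 A2 <->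
  mx_regular p (G - ('X - p%:P)%:F^-1 *: mx_const F A1
                  - ('X - p%:P)%:F^-1 ^+ 2 *: mx_const F A2).
Proof.
split=> [[G1 -> [U [_ Up] aU]] i j|rG].
  rewrite addrAC addrK addrK; apply: (@regular_of_derivable C F m G1 p i j).
  exact: aU.
exists (G - ('X - p%:P)%:F^-1 *: mx_const F A1
          - ('X - p%:P)%:F^-1 ^+ 2 *: mx_const F A2); first by rewrite addrAC subrK subrK.
set G1 := G - _ - _ in rG *.
exists (interior [set z : C^o | mx_regular z G1]).
  split; first exact: open_interior.
  have FG : Filter (nbhs (p : C^o)) by exact: nbhs_filter.
  suff : \forall z \near (p : C^o), mx_regular z G1 by [].
  have h i j := @near_regularT C F C^o (nbhs (p : C^o)) FG (G1 i j) idfun p (rG i j)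
    (fun (B : set C^o) nB => nB).
  have h' i := @filter_forall C^o _ (fun j => [set t | regular t (G1 i j)]) _ FG (h i).
  exact: (@filter_forall C^o _ (fun i => [set t | forall j, regular t (G1 i j)]) _ FG h').
move=> z /interior_subset rz; exact: (@derivable_mx_eval C F m G1 z rz).
Qed.

Lemma mx_normalized_residualE G p :
  mx_regular p (('X - p%:P)%:F *: G) ->
  mx_normalized_residual G p =
    p^-1 *: ('i%C *: mx_eval (('X - p%:P)%:F *: G) p).
Proof.
move=> rG; rewrite /mx_normalized_residual; congr (_ *: _).
have FP : ProperFilter ((p : C^o)^') by exact: Proper_dnbhs_numFieldType.
have FI : Filter ((p : C^o)^') by exact: filter_filter.
apply: (@cvg_lim _ (@norm_hausdorff C 'M[C^o]_m) C^o (p : C^o)^' FP).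
apply/cvg_mxP => i j.
have hid : z @[z --> (p : C^o)^'] --> (p : C^o).
  by move=> B nB; exact: (nbhs_dnbhs nB).
have hne : \forall z \near (p : C^o)^', z != p by exact: nbhs_dnbhs_neq.
have rij : regular p (('X - p%:P)%:F * G i j) by have := rG i j; rewrite mxE.
have h := @cvg_rf_eval C F C^o (p : C^o)^' FI _ idfun p rij hid.
have h2 := @cvg_mull C C^o (p : C^o)^' FI _ 'i%C _ h.
rewrite !mxE; apply: cvg_trans h2; apply: near_eq_cvg.
apply: filterS (@near_regular C F C^o (p : C^o)^' FI (G i j) idfun p hid hne) => z rz /=.
rewrite rf_evalM ?regularP // rf_evalP hornerXsubC !mxE.
by rewrite mulrCA.
Qed.

Lemma arc_cisP z : nrm z = 1 -> 0 < Im z ->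
  exists2 th : R, 0 < th < pi & z = cis th.
Proof.
move=> /nrm_eq1 n1 iz; exists (acos (Re z)).
  have [c1 c2] : -1 < Re z /\ Re z < 1 by split; nra.
  by rewrite acos_gt0 ?acos_ltpi ?c1 ?c2 ?ltW.
have c : -1 <= Re z <= 1 by apply/andP; split; nra.
have s2 : 1 - Re z ^+ 2 = Im z ^+ 2 by nra.
rewrite /cis acosK // sin_acos // s2 sqrtr_sqr ger0_norm ?ltW //.
by case: (z).
Qed.

Lemma nrm_gt1E z : (1 < `|z|) = (1 < nrm z).
Proof. by rewrite normE -ltcR. Qed.

Lemma cis_Im_gt0 (th : R) : 0 < th < pi -> 0 < Im (cis th).
Proof. exact: sin_gt0_pi. Qed.

(** The characterization over an abstract field of rational functions, whose
    notions of pole, value and residue become those of transfer functions when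
    that field is the field of fractions. *)
Theorem boundary_characterization G : G^T = G ->
  (forall i j, rf_real (G i j)) ->
  (exists L : 'M[C^o]_m,
    (mx_eval G w^-1 : 'M[C^o]_m) @[w --> (0 : C^o)^'] --> L) ->
  [/\ forall i j, rf_real (G i j),
      mx_analytic_on [set z | 1 < `|z|] G &
      forall z, 1 < `|z| ->
        [/\ 0 < Im z -> loewner_le 0 (niform (mx_eval G z)),
            Im z = 0 -> niform (mx_eval G z) = 0 &
            Im z < 0 -> loewner_le (niform (mx_eval G z)) 0]] <->
  [/\ forall z, 1 < `|z| -> ~ (0 < mx_order G z)%N,
      forall theta : R, 0 < theta < pi -> ~ (0 < mx_order G (cis theta))%N ->
        loewner_le 0 (niform (mx_eval G (cis theta))),
      forall theta0 : R, 0 < theta0 < pi -> (0 < mx_order G (cis theta0))%N ->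
        mx_order G (cis theta0) = 1%N /\
        psdmx (mx_normalized_residual G (cis theta0)),
      (0 < mx_order G 1%R)%N ->
        (mx_order G 1%R <= 2)%N /\
        exists A1 A2 : 'M[C]_m,
          [/\ mx_has_residues G 1 A1 A2, A1 \is hermsymmx, A2 \is hermsymmx,
              loewner_le 0 A2 & loewner_le A2 A1] &
      (0 < mx_order G (-1)%R)%N ->
        (mx_order G (-1)%R <= 2)%N /\
        exists A1 A2 : 'M[C]_m,
          [/\ mx_has_residues G (-1) A1 A2, A1 \is hermsymmx, A2 \is hermsymmx,
              loewner_le A2 0 & loewner_le (- A2) A1]].
Proof.
move=> Gsym Greal [L hL].
have Esym z : (mx_eval G z)^T = mx_eval G z by rewrite mx_eval_tr Gsym.
have N1 : (-1 : C) = (-1)%:C by rewrite rmorphN1.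
split.
- move=> [_ aG nG].
  have oG z : 1 < nrm z -> mx_regular z G.
    rewrite -nrm_gt1E => nz i j; apply: (@regular_of_derivable C F m G z i j).
    exact: aG.
  have nQ x z : 1 < nrm z -> 0 < Im z -> Im (rf_eval (qform (rcst F) x G) z) <= 0.
    move=> nz iz; have [_ ->] := qform_eval x (oG z nz).
    have nz' : 1 < `|z| by rewrite nrm_gt1E.
    have [/(_ iz) h _ _] := nG z nz'.
    by move: x; apply/niform_ge0.
  split.
  + by move=> z; rewrite nrm_gt1E => nz; apply/mx_order_eq0P; exact: oG.
  + move=> th hth /mx_order_eq0P rG; apply/niform_ge0 => // x.
    have [rQ <-] := qform_eval x rG.
    by apply: (arc_Im_le0 oG nQ) => //; [exact: nrm_cis|exact: cis_Im_gt0].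
  + move=> th hth pole; have iz := cis_Im_gt0 hth.
    have ord1 := mx_order_arc Gsym oG nQ (nrm_cis th) iz.
    split; first by apply/eqP; rewrite eqn_leq ord1.
    rewrite mx_normalized_residualE; first exact: (arc_residue_psd Gsym oG nQ (nrm_cis th) iz).
    by rewrite -[('X - _)%:F]expr1; apply/mx_order_leP.
  + move=> _; split; first exact: (mx_order_real Gsym Greal oG nQ (or_introl erefl)).
    have [A1 [A2 [rA h1 h2]]] := real_pole_residues Gsym Greal oG nQ (or_introl erefl).
    rewrite scale1r => p2 p1.
    exists A1, A2; split; [|exact: h1|exact: h2| |exact: p1].
    * by apply/mx_has_residuesP.
    * rewrite /loewner_le subr0; exact: p2.
  + have hs : (-1 : R) = 1 \/ (-1 : R) = -1 by right.
    move=> _; rewrite N1; split; first exact: (mx_order_real Gsym Greal oG nQ hs).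
    have [A1 [A2 [rA h1 h2]]] := real_pole_residues Gsym Greal oG nQ hs.
    rewrite rmorphN1 scaleN1r opprK => p2 p1.
    exists A1, A2; split; [|exact: h1|exact: h2| |].
    * by apply/mx_has_residuesP; rewrite N1.
    * rewrite /loewner_le sub0r; exact: p2.
    * rewrite /loewner_le opprK; exact: p1.
move=> [c1 c2 c3 c4 c5].
have oG z : 1 < nrm z -> mx_regular z G.
  by rewrite -nrm_gt1E => nz; apply/mx_order_eq0P; exact: c1.
have dG x : decays (qform (rcst F) x G) by exact: proper_decays hL.
have notreg z : ~ mx_regular z G -> (0 < mx_order G z)%N.
  by move=> nr; apply: contrapT => /mx_order_eq0P.
have nQ : forall x z, 1 < nrm z -> 0 < Im z -> Im (rf_eval (qform (rcst F) x G) z) <= 0.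
  apply: ni_of_boundary => //.
  - move=> z nz iz rG; have [th hth zE] := arc_cisP nz iz.
    apply/(niform_ge0 (Esym z)); rewrite zE; apply: c2; first exact: hth.
    by apply/mx_order_eq0P; rewrite -zE.
  - move=> z nz iz /notreg pole; have [th hth zE] := arc_cisP nz iz.
    rewrite zE in pole *; have [ord1 psd] := c3 th hth pole.
    have rG : mx_regular (cis th) (('X - (cis th)%:P)%:F *: G).
      by rewrite -[('X - _)%:F]expr1; apply/mx_order_leP; rewrite ord1.
    split=> // x; rewrite -mx_normalized_residualE //.
    exact: psdmx_qform.
  move=> s [->|->] /notreg pole.
    have [_ [A1 [A2 [hA _ _ p2 p1]]]] := c4 pole.
    have rA := (mx_has_residuesP G _ A1 A2).1 hA.
    exists A1, A2; split=> // x.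
      by rewrite mul1r; move: p2; rewrite /loewner_le subr0 => /psdmx_qform.
    by rewrite mul1r -qformB; exact: psdmx_qform.
  rewrite -N1 in pole *.
  have [_ [A1 [A2 [hA _ _ p2 p1]]]] := c5 pole.
  have rA := (mx_has_residuesP G _ A1 A2).1 hA.
  exists A1, A2; split=> // x.
    rewrite mulN1r -qformN; move: p2; rewrite /loewner_le sub0r => h; exact: (psdmx_qform h).
  rewrite mulN1r opprK -qformD; move: p1; rewrite /loewner_le opprK => h; exact: (psdmx_qform h).
have up z x : 1 < nrm z -> 0 < Im z -> Im (qform rc x (mx_eval G z)) <= 0.
  by move=> nz iz; have [_ <-] := qform_eval x (oG z nz); exact: nQ.
split; first exact: Greal.
  move=> z /=; rewrite nrm_gt1E => nz; exact: (@derivable_mx_eval C F m G z (oG z nz)).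
move=> z; rewrite nrm_gt1E => nz; split=> iz.
- by apply/(niform_ge0 (Esym z)) => x; exact: up.
- apply: (niform_eq0 (Esym z)) => x; have [rQ <-] := qform_eval x (oG z nz).
  by apply: rf_real_Im0 => //; exact: qform_real.
apply: (niform_le0 (Esym z)) => x.
have nzJ : 1 < nrm (conjc z) by rewrite nrmJ.
have izJ : 0 < Im (conjc z) by case: (z) iz => a b /=; rewrite oppr_gt0.
have := up (conjc z) x nzJ izJ.
have [_ <-] := qform_eval x (oG _ nzJ).
have [rQ <-] := qform_eval x (oG z nz).
have [_ ->] := rf_real_conj (qform_real x Greal) rQ.
by case: (rf_eval _ z) => a b /=; rewrite oppr_le0.
Qed.

End DiscreteNegativeImaginary.

Theorem lemma11 (R : realType) (m : nat) (G : transfer_function R m)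
  (Gsym : G^T = G) (Greal : tf_real G) (Gproper : tf_proper G) :
  D_NI G <->
  [/\ (* i *)
      forall z : R[i], 1 < `|z| -> ~ is_pole G z,
      (* ii *)
      forall theta : R, 0 < theta < pi -> ~ is_pole G (cis theta) ->
        loewner_le 0 (ni_mx G (cis theta)),
      (* iii *)
      forall theta0 : R, 0 < theta0 < pi -> is_pole G (cis theta0) ->
        pole_order G (cis theta0) = 1%N /\
        psdmx (normalized_residual G (cis theta0)),
      (* iv *)
      is_pole G 1 ->
        (pole_order G 1%R <= 2)%N /\
        exists A1 A2 : 'M[R[i]]_m,
          [/\ has_residues G 1 A1 A2, A1 \is hermsymmx, A2 \is hermsymmx,
              loewner_le 0 A2 & loewner_le A2 A1] &
      (* v *)
      is_pole G (-1) ->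
        (pole_order G (-1)%R <= 2)%N /\
        exists A1 A2 : 'M[R[i]]_m,
          [/\ has_residues G (-1) A1 A2, A1 \is hermsymmx, A2 \is hermsymmx,
              loewner_le A2 0 & loewner_le (- A2) A1]].
Proof.
exact: (@boundary_characterization R m (fraction_ratfun R[i]) G Gsym Greal Gproper).
Qed.
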